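(* Let $(W,S)$ be a Coxeter system with weight function $L$, let $S'\subseteq S$, $W'=\langle S'\rangle$, let $X$ be the set of distinguished left coset representatives of $W'$ in $W$, and let $p^*_{xu,yv}\in A$ ($x,y\in X$, $u,v\in W'$) be the relative Kazhdan--Lusztig polynomials and $M^s_{y,w}$ the elements defined in the context. Then, for all $x,y\in X$ and $u,v\in W'$, the following recursion formulae hold. (a) If $y=1$, then $p^*_{xu,v}=1$ if $x=1$ and $u=v$, and $p^*_{xu,v}=0$ otherwise. (b) Assume that $y\neq 1$ and let $s\in S$ be such that $sy<y$. If $sx\notin X$, set $t:=x^{-1}sx\in S'$. If $L(s)=0$, then $$p^*_{xu,yv}=\begin{cases} p^*_{sxu,syv} & \text{if } sx\in X,\\ p^*_{xtu,syv} & \text{if } sx\notin X.\end{cases}$$ If $L(s)>0$, then $$p^*_{xu,yv}=\begin{cases} p^*_{sxu,syv}+\varepsilon^{L(s)}p^*_{xu,syv}-\tilde p^{\,s}_{xu,yv} & \text{if } sx<x,\\ \varepsilon^{-L(s)}p^*_{sxu,yv} & \text{if } sx>x,\ sx\in X,\\ 0 & \text{if } sx\notin X,\ tu>u,\\ \displaystyle(\varepsilon^{L(s)}+\varepsilon^{-L(s)})p^*_{xu,syv}-\tilde p^{\,s}_{xu,yv}+p^*_{xtu,syv}+\sum_{w\in W',\ u<w<tw}M^t_{u,w}\,p^*_{xw,syv} & \text{if } sx\notin X,\ tu<u, \end{cases}$$ where $$\tilde p^{\,s}_{xu,yv}:=\sum_{\substack{z\in X,\ w\in W'\\ x\le z\le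 sy\text{ and } szw<zw<syv}} p^*_{xu,zw}\,M^s_{zw,syv}.$$
   Context: $(W,S)$ is a Coxeter system with $S$ finite, $l$ the length function, $\le$ the Bruhat--Chevalley order on $W$. $\Gamma$ is an abelian group (written additively) with a total order $\le$ compatible with addition. $L:W\to\Gamma$ is a weight function: elements $p_s\in\Gamma$ ($s\in S$) are given with $p_s=p_t$ whenever $s,t$ are conjugate in $W$, and $L(w)=p_{s_1}+\dots+p_{s_k}$ for any reduced expression $w=s_1\cdots s_k$. Assume $L(s)\ge 0$ for all $s\in S$. $R\subseteq\mathbb{C}$ is a subring and $A=R[\Gamma]$ is the group ring, with $R$-basis $\{\varepsilon^g\mid g\in\Gamma\}$, $\varepsilon^g\varepsilon^{g'}=\varepsilon^{g+g'}$. $A_{<0}$ denotes the $R$-span of all $\varepsilon^g$ with $g<0$; similarly $\mathbb{Z}[\Gamma_{<0}]$ is the $\mathbb{Z}$-span of these. The bar involution $a\mapsto\bar a$ of $A$ is $R$-linear with $\overline{\varepsilon^g}=\varepsilon^{-g}$. $\mathcal{H}$ is the generic Iwahori--Hecke algebra: the $A$-algebra with $A$-basis $\{\tilde T_w\mid w\in W\}$ and multiplication, for $s\in S$: $\tilde T_s\tilde T_w=\tilde T_{sw}$ if $l(sw)>l(w)$, and $\tilde T_s\tilde T_w=\tilde T_{sw}+(\varepsilon^{L(s)}-\varepsilon^{-L(s)})\tilde T_w$ if $l(sw)<l(w)$. The bar involution extends to a ring involution of $\mathcal{H}$ by $\overline{\sum_w a_w\tilde T_w}=\sum_w\bar a_w\tilde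 T_{w^{-1}}^{-1}$. The Kazhdan--Lusztig basis $\{C'_w\mid w\in W\}$ of $\mathcal{H}$ is uniquely determined by $\overline{C'_w}=C'_w$ and $C'_w=\sum_{y\in W}P^*_{y,w}\tilde T_y$ with $P^*_{w,w}=1$ and $P^*_{y,w}\in\mathbb{Z}[\Gamma_{<0}]$ for $y\ne w$ (and $P^*_{y,w}=0$ unless $y\le w$). For $s\in S$ with $L(s)>0$ and $y,w\in W$ with $sy<y<w<sw$, the elements $M^s_{y,w}\in\mathbb{Z}[\Gamma]$ are defined by the expansion $\tilde T_sC'_w=C'_{sw}-\varepsilon^{-L(s)}C'_w+\sum_{y\in W,\ sy<y<w}M^s_{y,w}C'_y$, valid for $sw>w$; they satisfy $\overline{M}{}^s_{y,w}=M^s_{y,w}$. (For $sw<w$ and $L(s)>0$ one has $\tilde T_sC'_w=\varepsilon^{L(s)}C'_w$; for $L(s)=0$ one has $\tilde T_sC'_w=C'_{sw}$.) For $S'\subseteq S$ and $W'=\langle S'\rangle$, the set $X$ of distinguished left coset representatives consists of the elements of minimal length in the cosets $wW'$; every $w\in W$ is uniquely $w=xu$ with $x\in X$, $u\in W'$, and $l(w)=l(x)+l(u)$. For $x\in X$, $s\in S$, exactly one of the following holds: $sx<x$ and $sx\in X$; $sx>x$ and $sx\in X$; $sx>x$ and $sx\notin X$, in which case $sx=xt$ with $t=x^{-1}sx\in S'$. Relative Kazhdan--Lusztig polynomials: for $y\in X$, $v\in W'$ there is a unique expression $C'_{yv}=\sum_{x\in X,\,u\in W'}p^*_{xu,yv}\,\tilde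 T_xC'_u$ with $p^*_{xu,yv}\in A$; it is known that $p^*_{yv,yv}=1$, $p^*_{xu,yv}\in A_{<0}$ if $xu\ne yv$, and $p^*_{xu,yv}=0$ unless $xu=yv$ or $x<y$. *)

(* Defs.v *)
From HB Require Import structures.
From Stdlib Require Import Relation_Operators.
From mathcomp Require Import all_boot all_order all_algebra.
From mathcomp Require Import boolp classical_sets functions cardinality fsbigop.
From mathcomp Require Import reals complex.

Set Implicit Arguments.
Unset Strict Implicit.
Unset Printing Implicit Defensive.

Import Order.TTheory GRing.Theory Num.Theory.
Local Open Scope classical_set_scope.
Local Open Scope ring_scope.

(** * Coxeter systems *)

Definition is_subgroup (W : groupType) (A : set W) : Prop :=
  [/\ A 1%g,
      forall v w, A v -> A w -> A (v * w)%g &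
      forall w, A w -> A (w^-1)%g].

Definition gen_subgroup (W : groupType) (A : set W) : set W :=
  smallest (@is_subgroup W) A.

(* The last field is the universal property of the presentation
   < S | (st)^m(s,t) = 1 whenever the order m(s,t) of st is finite >.
   Quantifying over all n with (st)^n = 1 amounts to the same relations,
   since these n are the multiples of m(s,t), or only 0 if st has infinite
   order. *)
Record coxeter_system (W : groupType) (S : set W) : Prop := CoxeterSystem {
  cox_order2 : forall s, S s -> s <> 1%g /\ (s * s = 1)%g;
  cox_generated : gen_subgroup S = setT;
  cox_presented : forall (G : groupType) (f : W -> G),
    (forall s t n, S s -> S t ->
       ((s * t) ^+ n = 1)%g -> ((f s * f t) ^+ n = 1)%g) ->
    exists phi : W -> G,
      (forall v w, phi (v * w)%g = (phi v * phi w)%g) /\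
      (forall s, S s -> phi s = f s) }.

Definition word_of (W : groupType) (S : set W) (w : W) (ws : seq W) : Prop :=
  (forall s, s \in ws -> S s) /\ (\prod_(s <- ws) s)%g = w.

Definition word_size (W : groupType) (S : set W) (w : W) (n : nat) : Prop :=
  exists ws, word_of S w ws /\ size ws = n.

(* The default value 0 is only used outside the subgroup generated by S. *)
Definition len (W : groupType) (S : set W) (w : W) : nat :=
  xget 0%N [set n | word_size S w n /\
                    forall m, word_size S w m -> (n <= m)%N].

Definition reduced_word (W : groupType) (S : set W) (w : W) (ws : seq W) :
    Prop :=
  word_of S w ws /\ size ws = len S w.

Definition reflection (W : groupType) (S : set W) (t : W) : Prop :=
  exists s g, S s /\ t = (s ^ g)%g.

Definition bruhat_step (W : groupType) (S : set W) (u w : W) : Prop :=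
  exists t, [/\ reflection S t, w = (u * t)%g & (len S u < len S w)%N].

Definition bruhat_le (W : groupType) (S : set W) : W -> W -> Prop :=
  clos_refl_trans W (bruhat_step S).

Definition bruhat_lt (W : groupType) (S : set W) (u w : W) : Prop :=
  bruhat_le S u w /\ u <> w.

Definition min_coset_reps (W : groupType) (S S' : set W) : set W :=
  [set x | forall u, gen_subgroup S' u -> (len S x <= len S (x * u)%g)%N].

(** * Weight functions *)

Definition ordered_group (Gamma : porderZmodType) : Prop :=
  (forall g h : Gamma, (g <= h) || (h <= g)) /\
  (forall g h k : Gamma, g <= h -> g + k <= h + k).

(* The parameters p_s are the values L s: a generator is a reduced word. *)
Definition weight_function (W : groupType) (S : set W)
    (Gamma : porderZmodType) (L : W -> Gamma) : Prop :=
  (forall s t g, S s -> S t -> t = (s ^ g)%g -> L s = L t) /\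
  (forall w ws, reduced_word S w ws -> L w = \sum_(s <- ws) L s).

(** * Linear combinations and bases *)

(* [\sum_(i \in D) f i] is 0 by convention when f has infinite support on D,
   hence the separate finiteness requirement. *)
Definition lin_comb (A : nzRingType) (V : lmodType A) (I : choiceType)
    (D : set I) (a : I -> A) (e : I -> V) (h : V) : Prop :=
  finite_set (D `&` [set i | a i <> 0]) /\ h = \sum_(i \in D) a i *: e i.

Definition is_basis (A : nzRingType) (V : lmodType A) (I : choiceType)
    (e : I -> V) : Prop :=
  forall h, exists! a : I -> A, lin_comb setT a e h.

(** * Group rings *)

(* A, with the family eps, is the group ring R[Gamma]. *)
Definition is_group_ring (R : comNzRingType) (Gamma : zmodType)
    (A : comAlgType R) (eps : Gamma -> A) : Prop :=
  is_basis eps /\ (forall g h, eps g * eps h = eps (g + h)).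

Definition is_group_ring_bar (R : comNzRingType) (Gamma : zmodType)
    (A : comAlgType R) (eps : Gamma -> A) (bar : A -> A) : Prop :=
  (forall (r : R) (a b : A), bar (r *: a + b) = r *: bar a + bar b) /\
  (forall g, bar (eps g) = eps (- g)).

(* Z-span of the eps g with g in D. *)
Definition int_span (Gamma : choiceType) (A : zmodType) (eps : Gamma -> A)
    (D : set Gamma) (a : A) : Prop :=
  exists c : Gamma -> int,
    finite_set (D `&` [set g | c g <> 0]) /\
    a = \sum_(g \in D) eps g *~ c g.

(** * Generic Iwahori-Hecke algebras *)

(* [T 1 = 1] has to be required: it does not follow from the multiplication
   rules when S is empty. *)
Definition is_hecke_algebra (W : groupType) (S : set W)
    (Gamma : porderZmodType) (L : W -> Gamma)
    (A : comNzRingType) (eps : Gamma -> A) (H : algType A) (T : W -> H) :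
    Prop :=
  [/\ is_basis T,
      T 1%g = 1,
      forall s w, S s -> (len S w < len S (s * w)%g)%N ->
        T s * T w = T (s * w)%g &
      forall s w, S s -> (len S (s * w)%g < len S w)%N ->
        T s * T w = T (s * w)%g + (eps (L s) - eps (- L s)) *: T w].

Definition is_hecke_bar (W : groupType) (A : comNzRingType) (bar : A -> A)
    (H : algType A) (T : W -> H) (barH : {rmorphism H -> H}) : Prop :=
  [/\ forall h, barH (barH h) = h,
      forall a h, barH (a *: h) = bar a *: barH h,
      forall w, barH (T w) * T (w^-1)%g = 1 &
      forall w, T (w^-1)%g * barH (T w) = 1].

Definition is_KL_basis (W : groupType) (S : set W)
    (Gamma : porderZmodType) (A : comNzRingType) (eps : Gamma -> A)
    (H : algType A) (T : W -> H) (barH : H -> H) (C : W -> H) : Prop :=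
  forall w, barH (C w) = C w /\
    exists P : W -> A,
      [/\ lin_comb setT P T (C w),
          P w = 1,
          forall y, y <> w -> int_span eps [set g | g < 0] (P y) &
          forall y, ~ bruhat_le S y w -> P y = 0].

Definition is_KL_M (W : groupType) (S : set W)
    (Gamma : porderZmodType) (L : W -> Gamma)
    (A : comNzRingType) (eps : Gamma -> A) (H : algType A)
    (T C : W -> H) (M : W -> W -> W -> A) : Prop :=
  forall s w, S s -> 0 < L s -> bruhat_lt S w (s * w)%g ->
    (forall y, bruhat_lt S (s * y)%g y -> bruhat_lt S y w ->
       int_span eps setT (M s y w)) /\
    T s * C w = C (s * w)%g - eps (- L s) *: C w
      + \sum_(y \in [set y | bruhat_lt S (s * y)%g y /\ bruhat_lt S y w])
          M s y w *: C y.

(** * Relative Kazhdan-Lusztig polynomials *)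

(* [p (x * u) (y * v)] is p*_{xu,yv}; indexing by elements of W is
   unambiguous since w = xu determines x and u. *)
Definition is_relative_KL (W : groupType) (S S' : set W)
    (A : comNzRingType) (H : algType A) (T C : W -> H) (p : W -> W -> A) :
    Prop :=
  forall y v, min_coset_reps S S' y -> gen_subgroup S' v ->
    lin_comb (min_coset_reps S S' `*` gen_subgroup S')
      (fun xu => p (xu.1 * xu.2)%g (y * v)%g)
      (fun xu => T xu.1 * C xu.2)
      (C (y * v)%g).

Definition ptilde (W : groupType) (S S' : set W) (A : comNzRingType)
    (M : W -> W -> W -> A) (p : W -> W -> A) (s x u y v : W) : A :=
  \sum_(zw \in [set zw : W * W |
          [/\ min_coset_reps S S' zw.1,
              gen_subgroup S' zw.2,
              bruhat_le S x zw.1 /\ bruhat_le S zw.1 (s * y)%g &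
              bruhat_lt S (s * zw.1 * zw.2)%g (zw.1 * zw.2)%g /\
              bruhat_lt S (zw.1 * zw.2)%g (s * y * v)%g]])
    p (x * u)%g (zw.1 * zw.2)%g * M s (zw.1 * zw.2)%g (s * y * v)%g.

(* Main.v *)
(** The proof computes in the basis [T_x C_u] ([x] in [X], [u] in [W']) of the
    Hecke algebra: it is unitriangular with respect to [T], and [p*_{xu,yv}] is
    the coordinate of [C_{yv}] at [T_x C_u].  For [sy < y], [C_{yv}] is expressed
    through [T_s C_{syv}], and the coordinates of [T_s h] follow from those of
    [h] by Deodhar's lemma: [T_s T_x] is [T_{sx}] up to a multiple of [T_x], or
    [T_x T_t] with [t = x^-1 s x] in [S'], and then [T_t C_u] is known.  The
    vanishing cases come from [T_s C_{yv} = eps^L(s) C_{yv}].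

    The exchange condition, not part of the definition of a Coxeter system by
    its presentation, is obtained from the left inversion cocycle: by the
    universal property, [s |-> (indicator of {s}, s)] extends to a morphism
    from [W] to the semidirect product of the functions [W -> bool] with [W]. *)

Require Import Defs.
From HB Require Import structures.
From Stdlib Require Import Relation_Operators.
From mathcomp Require Import all_boot all_order all_algebra.
From mathcomp Require Import boolp classical_sets functions cardinality fsbigop.
From mathcomp Require Import reals complex zify.

Set Implicit Arguments.
Unset Strict Implicit.
Unset Printing Implicit Defensive.

Import Order.TTheory GRing.Theory Num.Theory.
Local Open Scope classical_set_scope.
Local Open Scope ring_scope.

(** * The inversion cocycle *)

(** Two facts about [T s * C w] are not part of the data. If [0 < L s] and [s * w] is shorter than
    [w], it equals [eps (L s) *: C w]; this follows from the expansion defining [M]. If [L s = 0],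
    it equals [C (s * w)]; this comes from the principle that a bar-invariant element with all
    coordinates in [A_{<0}] is zero.

    The vanishing case opposes two scalars: [T s] multiplies the relevant coordinate both by
    [eps (L s)] and by [- eps (- L s)]. It remains that [eps (L s) + eps (- L s)] is not a zero
    divisor, which is where the total order on [Gamma] enters.

    When [s * x] is not in [X], the coordinate of [T s * h] is governed by a row of the matrix of
    [T t] in the basis [C]. Such a row may have infinitely many nonzero entries, but each [h] meets
    only finitely many of them.

    The bounds [x <= z <= sy] in [ptilde] do not occur in the expansion defining [M]. They discard
    only zero terms, because passing to minimal coset representatives is monotone for the Bruhat
    order. *)

Definition signed_conj (W : groupType) : Type := ((W -> bool) * W)%type.

Section SignedConjugation.
Variable W : groupType.
Local Open Scope group_scope.
Local Notation G := (signed_conj W).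
Implicit Types g h k : G.

HB.instance Definition _ := Choice.on G.

Definition sc_one : G := (fun=> false, 1).
(** The twist by [g.2] is chosen so that [w |-> (N w, w)] is multiplicative exactly when [N] obeys
    the cocycle rule for left inversions of a product. *)
Definition sc_mul g h : G := (fun r => g.1 r (+) h.1 (r ^ g.2), g.2 * h.2).
Definition sc_inv g : G := (fun r => g.1 (r ^ g.2^-1), g.2^-1).

Lemma sc_mulA : associative sc_mul.
Proof.
move=> g h k; rewrite /sc_mul /=; congr pair; last exact: mulgA.
by apply/funext => r; rewrite conjgM addbA.
Qed.

Lemma sc_mul1 : left_id sc_one sc_mul.
Proof.
case=> m a; rewrite /sc_mul /= mul1g; congr pair.
by apply/funext => r; rewrite conjg1.
Qed.

Lemma sc_mulr1 : right_id sc_one sc_mul.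
Proof.
case=> m a; rewrite /sc_mul /= mulg1; congr pair.
by apply/funext => r; rewrite addbF.
Qed.

Lemma sc_mulV : left_inverse sc_one sc_inv sc_mul.
Proof.
case=> m a; rewrite /sc_mul /= mulVg; congr pair.
by apply/funext => r; rewrite addbb.
Qed.

Lemma sc_mulrV : right_inverse sc_one sc_inv sc_mul.
Proof.
case=> m a; rewrite /sc_mul /= mulgV; congr pair.
by apply/funext => r; rewrite -conjgM mulgV conjg1 addbb.
Qed.

HB.instance Definition _ :=
  isGroup.Build G sc_mulA sc_mul1 sc_mulr1 sc_mulV sc_mulrV.

Lemma sc_mulE g h : g * h = sc_mul g h. Proof. by []. Qed.

Lemma sc_expE g n :
  g ^+ n = ((fun r => \big[addb/false]_(k < n) g.1 (r ^ (g.2 ^+ k))), g.2 ^+ n).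
Proof.
elim: n => [|n IHn].
  by apply: (congr2 pair) => //; apply/funext => r; rewrite big_ord0.
rewrite expgSr IHn sc_mulE /sc_mul /= expgSr; congr pair.
by apply/funext => r; rewrite big_ord_recr.
Qed.

End SignedConjugation.

Section Coxeter.
Variables (W : groupType) (S : set W).
Hypothesis WS : coxeter_system S.
Local Open Scope group_scope.
Implicit Types (a b w r s : W) (ws : seq W).

Lemma gen_subgroupP (A : set W) : is_subgroup (gen_subgroup A).
Proof.
split=> [D [[]] //|v w Av Aw D DA|w Aw D DA]; have [[D1 DM DV] _] := DA.
- exact: DM (Av D DA) (Aw D DA).
- exact: DV (Aw D DA).
Qed.

Lemma sub_gen (A : set W) s : A s -> gen_subgroup A s.
Proof. exact: sub_gen_smallest. Qed.

Lemma gen1 (A : set W) : gen_subgroup A 1.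
Proof. by case: (gen_subgroupP A). Qed.

Lemma genM (A : set W) v w :
  gen_subgroup A v -> gen_subgroup A w -> gen_subgroup A (v * w).
Proof. by case: (gen_subgroupP A) => _ AM _; apply: AM. Qed.

Lemma genV (A : set W) w : gen_subgroup A w -> gen_subgroup A w^-1.
Proof. by case: (gen_subgroupP A) => _ _; apply. Qed.

Lemma cox_inv s : S s -> s^-1 = s.
Proof. by move=> Ss; apply: mulg1_eq; case: (cox_order2 WS Ss). Qed.

Lemma coxK s w : S s -> s * (s * w) = w.
Proof. by move=> Ss; rewrite -{1}(cox_inv Ss) mulKg. Qed.

Lemma conjg_eq_swap r a b : (r ^ a == b) = (r == a * b / a).
Proof.
by apply/eqP/eqP => [<-|->]; rewrite conjgE ?mulVKg ?mulgK // mulgVK mulKg.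
Qed.

(** With [c = s * t], the two tests in the [k]-th summand compare [r] with [c ^+ (2k) * s] and
    [c ^+ (2k+1) * s]. The sum thus runs over all [c ^+ j * s] with [j < 2n]; since [c ^+ n = 1],
    its two halves coincide and cancel modulo 2. *)
Lemma dihedral_cocycle s t n : S s -> S t -> (s * t) ^+ n = 1 ->
  forall r, \big[addb/false]_(k < n)
    ((r ^ ((s * t) ^+ k) == s) (+) ((r ^ ((s * t) ^+ k)) ^ s == t)) = false.
Proof.
move=> Ss St; set c := s * t => cn r.
have cs k : s * (c ^+ k)^-1 = c ^+ k * s.
  rewrite [RHS]conjgC conjXg; congr (_ * _).
  rewrite -expVgn /c; congr (_ ^+ k).
  by rewrite conjgE (cox_inv Ss) -mulgA coxK // invgM (cox_inv Ss) (cox_inv St).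
pose g k := r == c ^+ k * s.
have gE k : (r ^ (c ^+ k) == s) = g (k + k)%N.
  by rewrite /g expgnDr -mulgA -cs mulgA conjg_eq_swap.
have gE' k : ((r ^ (c ^+ k)) ^ s == t) = g (k + k).+1.
  rewrite /g expgS expgnDr.
  have -> : c * (c ^+ k * c ^+ k) * s = c ^+ k * (s * (t * s)) * (c ^+ k)^-1.
    have sts : s * (t * s) = c * s by rewrite /c mulgA.
    have cC : c * c ^+ k = c ^+ k * c by rewrite -expgS expgSr.
    by rewrite sts [c ^+ k * (c * s)]mulgA -cC -[_ * s / _]mulgA cs !mulgA.
  have ss : s * s = 1 by case: (cox_order2 WS Ss).
  rewrite -conjg_eq_swap; set x := r ^ _.
  by apply/eqP/eqP => [<-|->];
    rewrite conjgE (cox_inv Ss) -!mulgA coxK // ss mulg1.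
under eq_bigr => k _ do rewrite gE gE'.
have -> : forall m, \big[addb/false]_(k < m) (g (k + k)%N (+) g (k + k).+1) =
    \big[addb/false]_(0 <= j < m + m) g j.
  elim=> [|m IHm]; first by rewrite big_ord0 big_geq.
  by rewrite big_ord_recr /= IHm addnS addSn !big_nat_recr // addbA.
rewrite (@big_cat_nat _ _ _ n) ?leq_addr //=.
rewrite -{2}[n]add0n big_addn addnK.
under [X in _ (+) X]eq_bigr => j _ do rewrite /g expgnDr cn mulg1.
by rewrite addbb.
Qed.

(* For a reflection [r], [N w r] says that [r] is a left inversion of [w]. *)
Lemma inversion_cocycle : {N : W -> W -> bool |
  (forall s, S s -> N s = eq_op^~ s) /\
  (forall a b r, N (a * b) r = N a r (+) N b (r ^ a))}.
Proof.
apply: cid.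
pose f s : signed_conj W := (eq_op^~ s, s).
have [|phi [phiM phiS]] := cox_presented WS (f := f).
  move=> s t n Ss St cn; rewrite sc_expE /= cn; congr pair.
  by apply/funext => r; apply: dihedral_cocycle.
have phi1 : phi 1 = 1 by apply: (mulgI (phi 1)); rewrite -phiM !mulg1.
have phi2 w : (phi w).2 = w.
  have: gen_subgroup S w by rewrite (cox_generated WS).
  apply: (@smallest_sub _ _ _ [set w | (phi w).2 = w]) => [|s Ss] /=.
    2: by rewrite phiS.
  split=> /= [|v x vE xE|x xE]; rewrite ?phi1 ?phiM ?sc_mulE /= ?vE ?xE //.
  apply: (mulIg x); rewrite mulVg -{2}xE.
  by have := congr1 snd (phiM x^-1 x); rewrite mulVg phi1 => /= <-.
exists (fun w => (phi w).1); split=> [s Ss|a b r]; first by rewrite phiS.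
by rewrite phiM sc_mulE /= phi2.
Qed.

End Coxeter.

(** * Length and exchange *)

Section Length.
Variables (W : groupType) (S : set W).
Hypothesis WS : coxeter_system S.
Local Open Scope group_scope.
Implicit Types (A : set W) (a b w r s : W) (ws : seq W).
Local Notation l := (len S).
Local Notation N := (sval (inversion_cocycle WS)).

Lemma word_ofS A s w ws : A s -> word_of A w ws -> word_of A (s * w) (s :: ws).
Proof.
move=> As [wsA <-]; split=> [t|]; last by rewrite big_cons.
by rewrite inE => /predU1P[->//|/wsA].
Qed.

Lemma word_of_cat A v w vs ws :
  word_of A v vs -> word_of A w ws -> word_of A (v * w) (vs ++ ws).
Proof.
move=> [vsA <-] [wsA <-]; split=> [t|]; last by rewrite big_cat.
by rewrite mem_cat => /orP[/vsA|/wsA].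
Qed.

Lemma word_of1 A : word_of A 1 [::].
Proof. by split=> //; rewrite big_nil. Qed.

(** Words without formal inverses suffice because the letters are involutions: inverting an element
    reverses its word. *)
Lemma gen_word A w : A `<=` S -> gen_subgroup A w -> exists ws, word_of A w ws.
Proof.
move=> AS; apply: (@smallest_sub _ _ _ [set w | exists ws, word_of A w ws]).
  split=> [|v x [vs vP] [ws wP]|x [ws [wsA <-]]] /=.
  - by exists [::]; exact: word_of1.
  - by exists (vs ++ ws); exact: word_of_cat.
  elim: ws wsA => [|s ws IHws] wsA.
    by exists [::]; rewrite big_nil invg1; exact: word_of1.
  have [t tws|vs vP] := IHws; first by apply: wsA; rewrite inE tws orbT.
  have As : A s by apply: wsA; rewrite inE eqxx.
  exists (vs ++ [:: s]); rewrite big_cons invgM; apply: word_of_cat => //.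
  rewrite (cox_inv WS (AS _ As)) -[s in word_of _ s]mulg1.
  by apply: word_ofS => //; exact: word_of1.
move=> s As; exists [:: s]; rewrite -[s in word_of _ s]mulg1.
by apply: word_ofS => //; exact: word_of1.
Qed.

Lemma word_gen A w ws : word_of A w ws -> gen_subgroup A w.
Proof.
case=> wsA <-; elim: ws wsA => [|s ws IHws] wsA; first by rewrite big_nil; exact: gen1.
rewrite big_cons; apply: genM; first by apply: sub_gen; apply: wsA; rewrite inE eqxx.
by apply: IHws => t tws; apply: wsA; rewrite inE tws orbT.
Qed.

(** Since [S] generates [W], the default value in [len] is never reached. *)
Lemma lenP w : word_size S w (l w) /\ forall m, word_size S w m -> (l w <= m)%N.
Proof.
have ex : exists n, `[< word_size S w n >].
  have [] := @gen_word S w; rewrite ?(cox_generated WS) // => ws wP.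
  by exists (size ws); apply/asboolP; exists ws.
rewrite /len; apply: (@xgetPex _ 0%N
  [set n | word_size S w n /\ forall m, word_size S w m -> (n <= m)%N]).
case: (ex_minnP ex) => n /asboolP nP nmin; exists n; split=> // m mP.
by apply: nmin; apply/asboolP.
Qed.

Lemma reduced_ex w : exists ws, word_of S w ws /\ size ws = l w.
Proof. by case: (lenP w). Qed.

Lemma len_word w ws : word_of S w ws -> (l w <= size ws)%N.
Proof. by case: (lenP w) => _ lmin wP; apply: lmin; exists ws. Qed.

Lemma len1 : l 1 = 0%N.
Proof. by apply/eqP; rewrite -leqn0; apply: (@len_word _ [::]); exact: word_of1. Qed.

Lemma len_eq0 w : l w = 0%N -> w = 1.
Proof.
move=> lw; have [[|s ws] [[_ wE] sz]] := reduced_ex w; last by rewrite lw in sz.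
by rewrite -wE big_nil.
Qed.

Lemma len_mul v w : (l (v * w) <= l v + l w)%N.
Proof.
have [vs [vP <-]] := reduced_ex v; have [ws [wP <-]] := reduced_ex w.
by rewrite -size_cat; apply: len_word; exact: word_of_cat.
Qed.

Lemma len_gen s : S s -> (l s <= 1)%N.
Proof.
move=> Ss; apply: (@len_word _ [:: s]); rewrite -[s in word_of _ s]mulg1.
by apply: word_ofS => //; exact: word_of1.
Qed.

Lemma inv_gen s r : S s -> N s r = (r == s).
Proof. by case: (svalP (inversion_cocycle WS)) => NS _ /NS ->. Qed.

Lemma inv_mul a b r : N (a * b) r = N a r (+) N b (r ^ a).
Proof. by case: (svalP (inversion_cocycle WS)) => _ ->. Qed.

Lemma inv1 r : N 1 r = false.
Proof. by have := inv_mul 1 1 r; rewrite mulg1 conjg1 addbb. Qed.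

(** If [r] is the first letter, that letter is erased. Otherwise the cocycle rule makes the
    conjugate of [r] by the first letter an inversion of the remaining word, and a letter is erased
    there. The letters stay in [A], so the lemma serves parabolic subgroups as well as [W]. *)
Lemma inversion_deletion A w ws r : A `<=` S -> word_of A w ws -> N w r ->
  exists vs, word_of A (r * w) vs /\ (size vs).+1 = size ws.
Proof.
move=> AS [wsA <-]; elim: ws r wsA => [|s ws IHws] r wsA.
  by rewrite big_nil inv1.
have As : A s by apply: wsA; rewrite inE eqxx.
have wsA' t : t \in ws -> A t by move=> tws; apply: wsA; rewrite inE tws orbT.
rewrite big_cons inv_mul (inv_gen _ (AS _ As)).
have [->|_] := eqVneq r s.
  by rewrite (coxK WS _ (AS _ As)) => _; exists ws.
move=> /(IHws _ wsA')[vs [vP vs_size]]; exists (s :: vs).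
split; last by rewrite /= vs_size.
set x := \prod_(t <- ws) t in vP *.
have -> : r * (s * x) = s * (r ^ s * x).
  by rewrite [LHS]mulgA [r * s]conjgC -[LHS]mulgA.
exact: word_ofS.
Qed.

Lemma refl_conj r a : reflection S r -> reflection S (r ^ a).
Proof. by move=> [s [g [Ss ->]]]; exists s, (g * a); rewrite conjgM. Qed.

Lemma gen_refl s : S s -> reflection S s.
Proof. by move=> Ss; exists s, 1; rewrite conjg1. Qed.

Lemma reflK r w : reflection S r -> r * (r * w) = w.
Proof.
move=> [s [g [Ss ->]]]; rewrite mulgA -conjMg.
by case: (cox_order2 WS Ss) => _ ->; rewrite conj1g mul1g.
Qed.

(** For [r = s ^ g], the contributions of [g^-1] and [g] to the cocycle cancel modulo 2, and the
    middle letter [s] contributes 1. *)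
Lemma inv_refl r : reflection S r -> N r r.
Proof.
move=> [s [g [Ss ->]]]; have gK : (s ^ g) ^ g^-1 = s by rewrite conjgK.
have ss : s ^ s = s by rewrite conjgE mulKg.
have := inv_mul g^-1 g (s ^ g); rewrite mulVg inv1 gK.
have -> : N (s ^ g) = N (g^-1 * (s * g)) by [].
rewrite !inv_mul gK ss (inv_gen _ Ss) eqxx.
by case: (N _ _); case: (N _ _).
Qed.

(** Deleting a letter from a reduced word shows that an inversion shortens. Conversely, if [r] is
    not an inversion of [w], it is one of [r * w], and the first half shows that [w] is the shorter
    of the two. *)
Lemma inversionP r w : reflection S r -> N w r = (l (r * w) < l w)%N.
Proof.
have imp x : N x r -> (l (r * x) < l x)%N.
  have [ws [wP <-]] := reduced_ex x.
  by move=> /(inversion_deletion (@subset_refl _ S) wP)[vs [/len_word ? <-]].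
move=> rr; apply/idP/idP => [/imp //|]; apply: contraTT => Nw.
have: N (r * w) r by rewrite inv_mul inv_refl // conjgE mulKg (negPf Nw).
by move/imp; rewrite reflK // -leqNgt => /ltnW.
Qed.

Lemma refl_len_neq r w : reflection S r -> l (r * w) <> l w.
Proof.
move=> rr E; have := inversionP (r * w) rr; rewrite reflK // E ltnn.
by rewrite inv_mul inv_refl // conjgE mulKg inversionP // E ltnn.
Qed.

(** Length in a standard parabolic subgroup agrees with length in [W]: letters are prepended one at
    a time, and whenever the length drops, a letter is deleted without leaving [A]. *)
Lemma reduced_word_in A w : A `<=` S -> gen_subgroup A w ->
  exists ws, word_of A w ws /\ size ws = l w.
Proof.
move=> AS /(gen_word AS)[ws [wsA <-]]; elim: ws wsA => [|s ws IHws] wsA.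
  by exists [::]; rewrite big_nil len1; split=> //; exact: word_of1.
have As : A s by apply: wsA; rewrite inE eqxx.
have Ss := AS _ As.
have [t tws|vs [vP vs_size]] := IHws; first by apply: wsA; rewrite inE tws orbT.
rewrite big_cons; set x := \prod_(t <- ws) t in vP vs_size *.
have lvs : l x = size vs by rewrite vs_size.
have lesx := len_mul s x; have ls := len_gen Ss.
have lexsx := len_mul s (s * x); rewrite (coxK WS _ Ss) in lexsx.
have [sxx|sxx] := ltnP (l (s * x)) (l x).
  rewrite -inversionP in sxx; last exact: gen_refl.
  have [us [uP us_size]] := inversion_deletion AS vP sxx.
  exists us; split=> //; apply/eqP; rewrite eqn_leq.
  rewrite (@len_word _ us) ?andbT; last by case: uP => uA; split=> // t /uA /AS.
  by lia.
have ne := refl_len_neq (w := x) (gen_refl Ss).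
by exists (s :: vs); split; [exact: word_ofS|rewrite /=; lia].
Qed.

Lemma len_inc s w : S s -> (l w < l (s * w))%N -> l (s * w) = (l w).+1.
Proof. by move=> Ss; have := len_mul s w; have := len_gen Ss; lia. Qed.

Lemma len_dec s w : S s -> (l (s * w) < l w)%N -> l w = (l (s * w)).+1.
Proof. by move=> Ss sw; rewrite -{1}(coxK WS w Ss) len_inc // (coxK WS _ Ss). Qed.

Lemma len_incP s w : S s -> ~~ (l (s * w) < l w)%N -> (l w < l (s * w))%N.
Proof. by move=> /gen_refl /refl_len_neq -/(_ w); lia. Qed.

Lemma gen_ind A (P : W -> Prop) : A `<=` S -> P 1 ->
  (forall s w, A s -> gen_subgroup A w -> l (s * w) = (l w).+1 -> P w -> P (s * w)) ->
  forall w, gen_subgroup A w -> P w.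
Proof.
move=> AS P1 PS w Aw; have [ws [wP]] := reduced_word_in AS Aw.
elim: ws w {Aw} wP => [|s ws IHws] w [wsA <-]; first by rewrite big_nil.
have As : A s by apply: wsA; rewrite inE eqxx.
have ws_word : word_of A (\prod_(t <- ws) t) ws.
  by split=> // t tws; apply: wsA; rewrite inE tws orbT.
rewrite big_cons; set x := \prod_(t <- ws) t in ws_word * => /= sz.
have lex : (l x <= size ws)%N.
  by apply: len_word; case: ws_word => xA xE; split=> // t /xA /AS.
have lsx := len_mul s x; have ls := len_gen (AS _ As).
apply: PS => //; first exact: word_gen ws_word; first by lia.
by apply: IHws => //; lia.
Qed.

Lemma gen_ind_r A (P : W -> Prop) : A `<=` S -> P 1 ->
  (forall w s, gen_subgroup A w -> A s -> l (w * s) = (l w).+1 -> P w -> P (w * s)) ->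
  forall w, gen_subgroup A w -> P w.
Proof.
move=> AS P1 PS w Aw; have [ws [wP]] := reduced_word_in AS Aw.
elim/last_ind: ws w {Aw} wP => [|ws s IHws] w [wsA <-]; first by rewrite big_nil.
have As : A s by apply: wsA; rewrite mem_rcons inE eqxx.
have ws_word : word_of A (\prod_(t <- ws) t) ws.
  by split=> // t tws; apply: wsA; rewrite mem_rcons inE tws orbT.
pose x : W := \prod_(t <- ws) t.
have -> : \prod_(t <- rcons ws s) t = x * s by rewrite -cats1 big_cat big_seq1.
rewrite size_rcons -/x in ws_word * => sz.
have lex : (l x <= size ws)%N.
  by apply: len_word; case: ws_word => xA xE; split=> // t /xA /AS.
have lsx := len_mul x s; have ls := len_gen (AS _ As).
apply: PS => //; first exact: word_gen ws_word; first by lia.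
by apply: IHws => //; lia.
Qed.

Lemma gen_all w : gen_subgroup S w.
Proof. by rewrite (cox_generated WS). Qed.

(** Makes the ranges of the sums with coefficients [M] finite, as the elements below [w] have
    bounded length. *)
Lemma finite_len_le n : finite_set S -> finite_set [set w | (l w <= n)%N].
Proof.
move=> Sfin; elim: n => [|n IHn].
  by apply: (sub_finite_set _ (finite_set1 1)) => w /= /[!leqn0] /eqP /len_eq0.
apply: (sub_finite_set _
  (_ : finite_set ([set w | (l w <= n)%N] `|`
    [set s * w | s in S & w in [set w | (l w <= n)%N]]))).
  move=> w /= lw; have [?|lw'] := leqP (l w) n; first by left.
  right; have [[|s ws] [wP sz]] := reduced_ex w; first by rewrite -sz in lw'.
  case: wP => wsS <-; rewrite big_cons.
  exists s; first by apply: wsS; rewrite inE eqxx.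
  exists (\prod_(t <- ws) t) => //=; apply: (@leq_trans (size ws)).
    by apply: len_word; split=> // t tws; apply: wsS; rewrite inE tws orbT.
  by move: sz => /=; lia.
by rewrite finite_setU; split=> //; exact: finite_image2.
Qed.

End Length.

(** * Coset representatives and the Bruhat order *)

Section Bruhat.
Variables (W : groupType) (S S' : set W).
Hypotheses (WS : coxeter_system S) (S'S : S' `<=` S).
Local Open Scope group_scope.
Implicit Types (a b r s t u v w x y z : W).
Local Notation l := (len S).
Local Notation N := (sval (inversion_cocycle WS)).
Local Notation W' := (gen_subgroup S').
Local Notation X := (min_coset_reps S S').

Lemma bruhat_le_len a b : bruhat_le S a b -> a = b \/ (l a < l b)%N.
Proof.
elim=> {a b} [a b [t [_ _ ?]]|a|a b c _ [-> //|ab] _ [<-|bc]].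
- by right.
- by left.
- by right.
- by right; exact: ltn_trans bc.
Qed.

Lemma bruhat_refl a : bruhat_le S a a. Proof. exact: rt_refl. Qed.

Lemma bruhat_trans b a c : bruhat_le S a b -> bruhat_le S b c -> bruhat_le S a c.
Proof. exact: rt_trans. Qed.

Lemma bruhat_lt_len a b : bruhat_lt S a b -> (l a < l b)%N.
Proof. by case=> /bruhat_le_len[]. Qed.

(** The Bruhat order is defined with reflections on the right, inversions with reflections on the
    left; conjugation passes from one to the other. *)
Lemma bruhat_step_left a b : bruhat_step S a b ->
  exists r, [/\ reflection S r, a = r * b & N b r].
Proof.
case=> t [rt -> lt]; exists (t ^ (a * t)^-1).
have rt' := refl_conj (a * t)^-1 rt.
have aE : a = t ^ (a * t)^-1 * (a * t).
  by have := reflK WS 1 rt; rewrite mulg1 -conjgCV -mulgA => ->; rewrite mulg1.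
by split=> //; rewrite inversionP // -aE.
Qed.

Lemma refl_bruhat r w : reflection S r -> (l w < l (r * w))%N ->
  bruhat_lt S w (r * w).
Proof.
move=> rr lt; split; last by move=> E; rewrite -E ltnn in lt.
apply: rt_step; exists (r ^ w); split=> //; first exact: refl_conj.
by rewrite -conjgC.
Qed.

Lemma bruhat_gtP s w : S s -> bruhat_lt S w (s * w) <-> (l w < l (s * w))%N.
Proof.
move=> Ss; split; first exact: bruhat_lt_len.
by apply: refl_bruhat; apply: gen_refl.
Qed.

Lemma bruhat_ltP s w : S s -> bruhat_lt S (s * w) w <-> (l (s * w) < l w)%N.
Proof. by move=> Ss; rewrite -{2 4}(coxK WS w Ss); exact: bruhat_gtP. Qed.

(** A step down erases a letter from a word in [S']. *)
Lemma bruhat_gen z w : W' w -> bruhat_le S z w -> W' z.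
Proof.
move=> W'w zw.
elim: zw W'w => {z w} [a b /bruhat_step_left[r [_ -> Nr]] W'b|//|].
  have [ws [wP _]] := reduced_word_in WS S'S W'b.
  have [vs [vP _]] := inversion_deletion S'S wP Nr.
  exact: word_gen vP.
by move=> a b c _ ab _ bc W'c; apply: ab; apply: bc.
Qed.

Lemma coset_ex w : exists xu : W * W, [/\ X xu.1, W' xu.2 & w = xu.1 * xu.2].
Proof.
have ex : exists n, `[< exists u, W' u /\ l (w * u) = n >].
  by exists (l w); apply/asboolP; exists 1; rewrite mulg1; split=> //; exact: gen1.
case: (ex_minnP ex) => _ /asboolP[u [W'u <-]] umin.
exists (w * u, u^-1); split=> /= [v W'v||]; last by rewrite mulgK.
  apply: umin; apply/asboolP; exists (u * v); rewrite mulgA; split=> //.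
  exact: genM.
exact: genV.
Qed.

(** Appending [t] to [x * u] amounts to multiplying on the left by the reflection
    [r = xu t (xu)^-1]. By the cocycle rule [r] is an inversion of [x * u] only if it is one of [x],
    excluded by minimality of [x] since [r * x] lies in the coset of [x], or if [u t u^-1] is one of
    [u], excluded by [u * t] being longer than [u]. *)
Lemma coset_len x u : X x -> W' u -> l (x * u) = (l x + l u)%N.
Proof.
move=> Xx; move: u; apply: (gen_ind_r WS S'S); first by rewrite mulg1 (len1 WS) addn0.
move=> u t W'u S't lut /= lxu; have St := S'S S't.
set r := t ^ (x * u)^-1.
have rr : reflection S r by apply/refl_conj/gen_refl.
have rE : r * (x * u) = x * u * t by rewrite -conjgCV.
have := refl_len_neq WS (w := x * u) rr; rewrite rE.
have := len_mul WS (x * u) t; have := len_gen WS St.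
have -> : x * (u * t) = x * u * t by rewrite mulgA.
suff: ~~ (l (x * u * t) < l (x * u))%N by lia.
rewrite -rE -(inversionP WS) // (inv_mul WS) !(inversionP WS) //; last exact: refl_conj.
have rxE : r ^ x = t ^ u^-1 by rewrite /r invgM conjgM conjgKV.
rewrite rxE -conjgCV lut [((l u).+1 < _)%N]ltnNge leqnSn /= addbF -leqNgt.
have -> : r * x = x * (t ^ u^-1) by rewrite [LHS]conjgC rxE.
apply: Xx; rewrite conjgE; do !apply: genM => //; last exact: genV.
  by rewrite invgK.
exact: sub_gen.
Qed.

Lemma coset_uniq x x' u u' : X x -> X x' -> W' u -> W' u' ->
  x * u = x' * u' -> x = x' /\ u = u'.
Proof.
move=> Xx Xx' W'u W'u' E.
have W'v : W' (u * u'^-1) by apply: genM => //; exact: genV.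
have xE : x' = x * (u * u'^-1) by rewrite mulgA E mulgK.
have: u * u'^-1 = 1.
  apply: (len_eq0 WS); have := Xx' _ (genV W'v); have := coset_len Xx W'v.
  by rewrite -xE xE mulgK; lia.
by move=> uu'; move: xE E; rewrite uu' mulg1 => -> /mulgI.
Qed.

Lemma min_coset_reps1 : X 1.
Proof. by move=> u _; rewrite (len1 WS). Qed.

Lemma rep_desc s x : X x -> S s -> (l (s * x) < l x)%N -> X (s * x).
Proof.
move=> Xx Ss sx u W'u; have := coset_len Xx W'u; have := len_dec WS Ss sx.
have sK : s * (s * x * u) = x * u by rewrite -[s * x * u]mulgA (coxK WS _ Ss).
by have := len_mul WS s (s * x * u); have := len_gen WS Ss; rewrite sK; lia.
Qed.

(* Deodhar's lemma. *)
Lemma rep_asc s x : X x -> S s -> ~ X (s * x) -> S' (x^-1 * s * x).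
Proof.
move=> Xx Ss XNsx.
have sxx : (l x < l (s * x))%N.
  by apply: (len_incP WS) => //; apply/negP => /(rep_desc Xx Ss).
have [u [W'u lt]] : exists u, W' u /\ (l (s * x * u) < l (s * x))%N.
  apply: contrapT => nex; apply: XNsx => u W'u; rewrite leqNgt.
  by apply/negP => lt; apply: nex; exists u.
have lxu := coset_len Xx W'u; have lsx := len_inc WS Ss sxx.
have sE : s * x * u = s * (x * u) by rewrite mulgA.
have lsxu := len_mul WS s (s * (x * u)); have ls := len_gen WS Ss.
rewrite (coxK WS _ Ss) in lsxu; rewrite sE in lt.
have lu : l u = 1%N.
  have : l u <> 0%N by move=> /(len_eq0 WS) u1; move: lt; rewrite -sE u1 mulg1 ltnn.
  by lia.
have S'u : S' u.
  have [ws [[wsS' uE]]] := reduced_word_in WS S'S W'u.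
  rewrite lu -uE; case: ws wsS' {uE} => [|t []] // wsS' _.
  by rewrite big_seq1; apply: wsS'; rewrite inE.
(* As [s] is an inversion of [x * u] but not of [x], its conjugate [s ^ x] is an inversion of [u].
   Since [u] is a single letter, the two are equal. *)
have: N (x * u) s.
  by rewrite (inversionP WS); [lia|exact: gen_refl].
rewrite (inv_mul WS) (inversionP WS); last exact: gen_refl.
rewrite ltnNge (ltnW sxx) /= (inv_gen WS) ?conjgE ?mulgA; last exact: S'S.
by move=> /eqP ->.
Qed.

Lemma bruhat_coset_le x u : X x -> W' u -> bruhat_le S x (x * u).
Proof.
move=> Xx; move: u; apply: (gen_ind_r WS S'S); [by rewrite mulg1; exact: bruhat_refl|].
move=> u t W'u S't lut /= le; apply: bruhat_trans le _; apply: rt_step; exists t.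
split; [by apply/gen_refl/S'S|by rewrite mulgA|].
have W'ut : W' (u * t) by apply: genM => //; exact: sub_gen.
by rewrite (coset_len Xx W'u) (coset_len Xx W'ut) lut addnS.
Qed.

(** Consider one step down by a left inversion [r] of [y * v]. If [r] is not an inversion of [y], it
    comes from an inversion of [v] and the coset does not change. Otherwise [r * y] is below [y],
    and its minimal representative, which is [x], is below [r * y]. *)
Lemma bruhat_coset x y u v : X x -> X y -> W' u -> W' v ->
  bruhat_le S (x * u) (y * v) -> bruhat_le S x y.
Proof.
move=> Xx Xy W'u W'v; move aE: (x * u) => a; move bE: (y * v) => b ab.
elim: ab x y u v Xx Xy W'u W'v aE bE => {a b} [a b st|a|a b c _ ab _ bc]
  x y u v Xx Xy W'u W'v aE bE.
- have [r [rr aE' Nr]] := bruhat_step_left st.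
  move: Nr; rewrite -bE (inv_mul WS).
  have [Nyr _|Nyr /= Nvr] := boolP (N y r); last first.
    suff [-> _] : x = y /\ u = r ^ y * v by exact: bruhat_refl.
    have W'rv : W' (r ^ y * v).
      have [ws [wP _]] := reduced_word_in WS S'S W'v.
      have [vs [vP _]] := inversion_deletion S'S wP Nvr.
      exact: word_gen vP.
    apply: coset_uniq => //.
    by rewrite aE aE' -bE [y * (_ * _)]mulgA -conjgC mulgA.
  have [[z w] /= [Xz W'w ryE]] := coset_ex (r * y).
  have -> : x = z.
    have W'wv : W' (w * v) by exact: genM.
    have [] := coset_uniq Xx Xz W'u W'wv => //.
    by rewrite aE aE' -bE !mulgA ryE.
  apply: bruhat_trans (bruhat_coset_le Xz W'w) _; rewrite -ryE.
  have [] := @refl_bruhat r (r * y) rr; rewrite (reflK WS _ rr) // .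
  by rewrite -(inversionP WS).
- have [-> _] := coset_uniq Xx Xy W'u W'v (etrans aE (esym bE)).
  exact: bruhat_refl.
- have [[z w] /= [Xz W'w bE']] := coset_ex b.
  by apply: bruhat_trans (ab _ _ _ _ Xx Xz W'u W'w _ _) (bc _ _ _ _ Xz Xy W'w W'v _ _).
Qed.

End Bruhat.

(** * Bases and coordinates *)

(** Antisymmetry is not assumed, so that indices can be compared through a length or a rank. *)
Lemma finite_maximal (I : choiceType) (D : set I) (le : I -> I -> Prop) :
  (forall i j, le i j \/ le j i) ->
  (forall i j k, le i j -> le j k -> le i k) ->
  finite_set D -> D !=set0 -> exists i, D i /\ forall j, D j -> le j i.
Proof.
move=> le_total le_trans /finite_seqP[r ->] [i0 /= i0r].
have refl i : le i i by case: (le_total i i).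
elim: r i0 i0r => // i r IHr i0 _; case: r IHr => [_|j r IHr].
  by exists i; split=> [|k]; rewrite /= inE // => /eqP ->.
have [|k [kr kmax]] := IHr j; first by rewrite /= inE eqxx.
have [ik|ki] := le_total i k.
  exists k; split=> [|m]; rewrite /= inE ?kr ?orbT //.
  by move=> /predU1P[->|/kmax].
exists i; split=> [|m]; rewrite /= inE ?eqxx //.
by move=> /predU1P[->|/kmax mk] //; exact: le_trans ki.
Qed.

(** The list may exceed the support, which allows sums with different supports to be compared over a
    common list. *)
Lemma fsum_seq (V : nmodType) (I : choiceType) (D : set I) (g : I -> V)
    (r : seq I) :
  uniq r -> (forall i, D i -> g i <> 0 -> i \in r) ->
  \sum_(i \in D) g i = \sum_(i <- r | i \in D) g i.
Proof.
move=> r_uniq gr; rewrite [RHS]bigfs //; last first.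
  by move=> i; rewrite inE => Di; apply: contraNeq => /eqP; exact: gr.
by apply: eq_fsbigl; apply/seteqP; split=> i /=; rewrite inE.
Qed.

Lemma fsum_single (V : nmodType) (I : choiceType) (D : set I) (g : I -> V) i :
  D i -> (forall j, D j -> j <> i -> g j = 0) -> \sum_(j \in D) g j = g i.
Proof.
move=> Di g0; rewrite (@fsum_seq _ _ _ _ [:: i]) //.
  by rewrite big_cons big_nil mem_set // addr0.
move=> j Dj gj; rewrite inE; apply/eqP; apply: contrapT => ji.
by apply: gj; exact: g0.
Qed.

(** * Linear forms on a module *)

Section Forms.
Variables (A : comNzRingType) (V : lmodType A).
Implicit Types (f : V -> A) (a c : A) (h k : V).

(** A predicate on plain functions, so that coordinates and expressions built from them are forms
    without being packaged as linear maps. *)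
Definition is_form f := forall a h k, f (a *: h + k) = a * f h + f k.

Lemma form0 f : is_form f -> f 0 = 0.
Proof.
by move=> fP; have := fP (- 1) 0 0; rewrite scaler0 addr0 mulN1r addNr.
Qed.

Lemma formD f h k : is_form f -> f (h + k) = f h + f k.
Proof. by move=> fP; rewrite -{1}[h]scale1r fP mul1r. Qed.

Lemma formZ f a h : is_form f -> f (a *: h) = a * f h.
Proof. by move=> fP; rewrite -{1}[a *: h]addr0 fP form0 // addr0. Qed.

Lemma formN f h : is_form f -> f (- h) = - f h.
Proof. by move=> fP; rewrite -scaleN1r formZ // mulN1r. Qed.

Lemma formB f h k : is_form f -> f (h - k) = f h - f k.
Proof. by move=> fP; rewrite formD // formN. Qed.

Lemma form_sum f (J : Type) (r : seq J) (Q : pred J) (c : J -> A) (v : J -> V) :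
  is_form f ->
  f (\sum_(i <- r | Q i) c i *: v i) = \sum_(i <- r | Q i) c i * f (v i).
Proof.
move=> fP; rewrite (big_morph f (fun h k => formD h k fP) (form0 fP)).
by apply: eq_bigr => i _; rewrite formZ.
Qed.

Lemma form_fsum f (J : choiceType) (D : set J) (c : J -> A) (v : J -> V) :
  is_form f -> finite_set (D `&` [set i | c i <> 0]) ->
  f (\sum_(i \in D) c i *: v i) = \sum_(i \in D) c i * f (v i).
Proof.
move=> fP /finite_seqP[r rE].
have cr i : D i -> c i <> 0 -> i \in undup r.
  by move=> Di ci; rewrite mem_undup; have : [set` r] i by rewrite -rE.
rewrite (@fsum_seq _ _ _ _ (undup r)) ?undup_uniq //; last first.
  by move=> i Di ci; apply: cr => // ci0; apply: ci; rewrite ci0 scale0r.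
rewrite (@fsum_seq _ _ _ _ (undup r)) ?undup_uniq //; last first.
  by move=> i Di ci; apply: cr => // ci0; apply: ci; rewrite ci0 mul0r.
exact: form_sum.
Qed.

Lemma form_lincomb f (c : A) (g : V -> A) : is_form f -> is_form g ->
  is_form (fun h => c * f h + g h).
Proof.
move=> fP gP a h k; rewrite fP gP !mulrDr addrACA; congr (_ + _ + _).
by rewrite mulrCA.
Qed.

End Forms.

(** * Coordinates in a basis and unitriangular changes of basis *)

Section Bases.
Variables (A : comNzRingType) (V : lmodType A) (I : choiceType) (e : I -> V).
Hypothesis e_basis : is_basis e.
Implicit Types (a b : I -> A) (h k : V).

Lemma lin_comb_seq (f : I -> V) a h : lin_comb setT a f h <->
  exists r, [/\ uniq r, forall i, a i <> 0 -> i \in r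
              & h = \sum_(i <- r) a i *: f i].
Proof.
have sumE r : uniq r -> (forall i, a i <> 0 -> i \in r) ->
    \sum_(i \in setT) a i *: f i = \sum_(i <- r) a i *: f i.
  move=> r_uniq ar; rewrite (fsum_seq r_uniq).
    by apply: eq_bigl => i; rewrite mem_set.
  by move=> i _ ai; apply: ar => ai0; apply: ai; rewrite ai0 scale0r.
split=> [[/finite_seqP[r rE] ->]|[r [r_uniq ar ->]]].
  have ar i : a i <> 0 -> i \in undup r.
    by move=> ai; rewrite mem_undup; have : [set` r] i by rewrite -rE.
  by exists (undup r); rewrite undup_uniq; split=> //; apply: sumE; rewrite ?undup_uniq.
split; last by rewrite (sumE r).
apply: (@sub_finite_set _ _ [set` r]) => [i [_ /ar //]|].
exact: finite_seq.
Qed.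

Lemma lin_comb_lincomb (f : I -> V) (c : A) a b h k :
  lin_comb setT a f h -> lin_comb setT b f k ->
  lin_comb setT (fun i => c * a i + b i) f (c *: h + k).
Proof.
move=> /lin_comb_seq[r [r_uniq ar hE]] /lin_comb_seq[q [q_uniq bq kE]].
apply/lin_comb_seq; exists (undup (r ++ q)); rewrite undup_uniq.
have wide (d : I -> A) (s : seq I) : uniq s -> (forall i, d i <> 0 -> i \in s) ->
    {subset s <= r ++ q} ->
    \sum_(i <- s) d i *: f i = \sum_(i <- undup (r ++ q)) d i *: f i.
  move=> s_uniq ds sub; rewrite [RHS](bigID (mem s)) /= [X in _ + X]big1 ?addr0.
    rewrite -[RHS]big_filter; apply: perm_big; apply: uniq_perm => //.
      by rewrite filter_uniq ?undup_uniq.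
    move=> i; rewrite mem_filter mem_undup; case: (boolP (i \in s)) => //= /sub.
    by move=> ->.
  move=> i /negP si; case: (eqVneq (d i) 0) => [->|/eqP /ds //]; exact: scale0r.
split=> //.
- move=> i abi; rewrite mem_undup mem_cat.
  have [ai|/eqP /ar -> //] := eqVneq (a i) 0.
  by rewrite bq ?orbT // => bi; apply: abi; rewrite ai bi mulr0 addr0.
- rewrite hE kE (wide a r) ?(wide b q) //; try by move=> i ir; rewrite mem_cat ir ?orbT.
  rewrite scaler_sumr -big_split /=; apply: eq_bigr => i _.
  by rewrite scalerDl scalerA.
Qed.

Definition coord h : I -> A := sval (cid (e_basis h)).

Lemma coordP h : lin_comb setT (coord h) e h.
Proof. by rewrite /coord; case: cid => a []. Qed.

Lemma coord_uniq a h : lin_comb setT a e h -> coord h = a.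
Proof. by rewrite /coord; case: cid => b [] _ /= + /[dup] => /[apply]. Qed.

Lemma coord_seq h : exists r, [/\ uniq r, forall i, coord h i <> 0 -> i \in r
  & h = \sum_(i <- r) coord h i *: e i].
Proof. exact/lin_comb_seq/coordP. Qed.

Lemma coord_form i : is_form (coord ^~ i).
Proof.
by move=> a h k; rewrite (coord_uniq (lin_comb_lincomb a (coordP h) (coordP k))).
Qed.

Lemma lin_comb_single (f : I -> V) i : lin_comb setT (fun j => (i == j)%:R) f (f i).
Proof.
apply/lin_comb_seq; exists [:: i]; split=> // [j|].
  by rewrite inE eq_sym; case: eqP.
by rewrite big_seq1 eqxx scale1r.
Qed.

Lemma coord_basis i j : coord (e i) j = (i == j)%:R.
Proof. by rewrite (coord_uniq (lin_comb_single e i)). Qed.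

(** Formulas for a coordinate of [T s * h] are linear in [h]; this reduces them to basis vectors. *)
Lemma form_ext (f g : V -> A) : is_form f -> is_form g ->
  (forall i, f (e i) = g (e i)) -> forall h, f h = g h.
Proof.
move=> fP gP fg h; have [r [_ _ ->]] := coord_seq h.
by rewrite !form_sum //; apply: eq_bigr => i _; rewrite fg.
Qed.

Lemma coord_inj h k : (forall i, coord h i = coord k i) -> h = k.
Proof.
move=> hk; have [_ ->] := coordP h; have [_ ->] := coordP k.
by apply: eq_fsbigr => i _; rewrite hk.
Qed.

Lemma form_expand (f : V -> A) h : is_form f -> f h <> 0 ->
  exists i, coord h i <> 0 /\ f (e i) <> 0.
Proof.
move=> fP; have [r [_ _ hE]] := coord_seq h; rewrite {1}hE form_sum // => fh.
apply: contrapT => nex; apply: fh; apply: big1 => i _.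
have [->|/eqP ci] := eqVneq (coord h i) 0; first by rewrite mul0r.
have [->|/eqP fi] := eqVneq (f (e i)) 0; first by rewrite mulr0.
by case: nex; exists i.
Qed.

(** Spanning goes by induction on the rank. For uniqueness, take an index [i] of maximal rank in a
    vanishing combination: at coordinate [i] of the old basis only the term of [i] contributes, so
    its coefficient is zero. *)
Lemma triangular_basis (rank : I -> nat) (f : I -> V) :
  (forall i, coord (f i) i = 1) ->
  (forall i j, coord (f i) j <> 0 -> j = i \/ (rank j < rank i)%N) ->
  is_basis f.
Proof.
move=> f1 ftri h.
pose spanned h := exists a, lin_comb setT a f h.
have spannedD c k1 k2 : spanned k1 -> spanned k2 -> spanned (c *: k1 + k2).
  by move=> [a aP] [b bP]; exists (fun i => c * a i + b i); exact: lin_comb_lincomb.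
have spanned0 : spanned 0.
  by exists (fun=> 0); apply/lin_comb_seq; exists [::]; rewrite big_nil.
have spanned_sum (r : seq I) (Q : pred I) (c : I -> A) (v : I -> V) :
    (forall i, i \in r -> Q i -> c i <> 0 -> spanned (v i)) ->
    spanned (\sum_(i <- r | Q i) c i *: v i).
  move=> vP; rewrite big_seq_cond; elim/big_rec: _ => // i x /andP[ir Qi] xP.
  have [->|/eqP ci] := eqVneq (c i) 0; first by rewrite scale0r add0r.
  by apply: spannedD => //; exact: vP.
have spanned_e i : spanned (e i).
  move: {2}(rank i).+1 (ltnSn (rank i)) => n; elim: n i => // n IHn i lin.
  have [r [r_uniq fr fE]] := coord_seq (f i).
  have ir : i \in r by apply: fr; rewrite f1; exact/eqP/oner_neq0.
  have -> : e i = (- 1) *: (\sum_(j <- r | j != i) coord (f i) j *: e j) + f i.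
    by rewrite {2}fE (bigD1_seq i) //= f1 !scale1r scaleN1r addrCA addNr addr0.
  apply: spannedD; last by exists (fun j => (i == j)%:R); exact: lin_comb_single.
  apply: spanned_sum => j jr /eqP ji /ftri[//|lt]; apply: IHn.
  exact: leq_trans lt _.
have [a aP] : spanned h.
  by have [r [_ _ ->]] := coord_seq h; apply: spanned_sum.
exists a; split=> // b bP; apply/funext => i0; apply/eqP; rewrite -subr_eq0.
apply/eqP; pose d i := (- 1) * b i + a i.
have: lin_comb setT d f 0.
  by have := lin_comb_lincomb (- 1) bP aP; rewrite scaleN1r addNr.
have -> : a i0 - b i0 = d i0 by rewrite /d mulN1r addrC.
move=> [dfin dsum]; apply: contrapT => di0.
have [|||i [[_ di] imax]] :=
  @finite_maximal _ _ (fun i j => (rank i <= rank j)%N) _ _ dfin.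
- by move=> i j; case: (leqP (rank i) (rank j)); [left|move/ltnW; right].
- by move=> i j k; exact: leq_trans.
- by exists i0.
apply: di; have := congr1 (coord ^~ i) dsum.
rewrite /= (form0 (coord_form i)) (form_fsum _ (coord_form i) dfin).
rewrite (@fsum_single _ _ _ _ i) //; first by rewrite f1 mulr1.
move=> j _ ji; have [->|/eqP dj] := eqVneq (d j) 0; first by rewrite mul0r.
have [->|/eqP fji] := eqVneq (coord (f j) i) 0; first by rewrite mulr0.
have [//|] := ftri _ _ fji; first by move=> ij; case: ji.
by rewrite ltnNge imax.
Qed.

End Bases.

(** [D] may be infinite: injectivity of [g] leaves only finitely many nonzero terms for each [h],
    and linearity is checked on one finite list covering the supports of both vectors. *)
Lemma is_form_fsum (A : comNzRingType) (V : lmodType A) (I J : choiceType)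
    (e : I -> V) (e_basis : is_basis e) (D : set J) (m : J -> A) (g : J -> I) :
  injective g ->
  is_form (fun h => \sum_(j \in D) m j * coord e_basis h (g j)).
Proof.
move=> g_inj a h k.
have fin h1 : finite_set [set j | coord e_basis h1 (g j) <> 0].
  have [cfin _] := coordP e_basis h1; rewrite setTI in cfin.
  by apply: (finite_preimage _ cfin) => i j _ _; exact: g_inj.
have /finite_seqP[r rE] : finite_set ([set j | coord e_basis h (g j) <> 0] `|`
    [set j | coord e_basis k (g j) <> 0]).
  by rewrite finite_setU; split; exact: fin.
have sumE h1 : [set j | coord e_basis h1 (g j) <> 0] `<=` [set` r] ->
   \sum_(j \in D) m j * coord e_basis h1 (g j) =
   \sum_(j <- undup r | j \in D) m j * coord e_basis h1 (g j).
  move=> sub; apply: fsum_seq; first exact: undup_uniq.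
  move=> j _ mj; rewrite mem_undup; apply: sub => /= cj.
  by apply: mj; rewrite cj mulr0.
have sub_h : [set j | coord e_basis h (g j) <> 0] `<=` [set` r].
  by rewrite -rE => j /= cj; left.
have sub_k : [set j | coord e_basis k (g j) <> 0] `<=` [set` r].
  by rewrite -rE => j /= cj; right.
rewrite (sumE h) // (sumE k) // sumE; last first.
  rewrite -rE => j /=; rewrite (coord_form e_basis (g j)) => cj.
  have [c0|/eqP ?] := eqVneq (coord e_basis h (g j)) 0; last by left.
  by right=> c0'; apply: cj; rewrite c0 c0' mulr0 addr0.
rewrite big_distrr -big_split /=; apply: eq_bigr => j _.
by rewrite (coord_form e_basis (g j)) mulrDr mulrCA.
Qed.

(** * Group rings *)

Section GroupRing.
Variables (R : comNzRingType) (Gamma : porderZmodType) (A : comAlgType R).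
Variables (eps : Gamma -> A) (bar : A -> A).
Hypotheses (Gamma_ordered : ordered_group Gamma) (AR : is_group_ring eps).
Hypothesis bar_A : is_group_ring_bar eps bar.
Implicit Types (a b : A) (g h k : Gamma).

Let eps_basis : is_basis eps := proj1 AR.
Local Notation gc := (coord eps_basis).

Lemma eps_mul g h : eps g * eps h = eps (g + h).
Proof. by case: AR => _; apply. Qed.

Lemma coord_eps_mul k a g : gc (eps k * a) g = gc a (g - k).
Proof.
pose f1 a := gc (eps k * a) g; pose f2 a := gc a (g - k).
apply: (@form_ext _ _ _ _ eps_basis f1 f2) => [c x y|c x y|h]; rewrite /f1 /f2.
- by rewrite mulrDr -scalerAr (coord_form eps_basis).
- exact: coord_form.
- by rewrite eps_mul !coord_basis [h == _]eq_sym subr_eq eq_sym addrC.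
Qed.

(** Multiplication by [eps 0] fixes every coordinate, so [eps 0] is the unit. *)
Lemma eps0 : eps 0 = 1.
Proof.
rewrite -[LHS]mulr1; apply: (@coord_inj _ _ _ _ eps_basis) => g.
by rewrite coord_eps_mul subr0.
Qed.

Lemma eps_mulN g : eps g * eps (- g) = 1.
Proof. by rewrite eps_mul subrr eps0. Qed.

Lemma coord_bar a g : gc (bar a) g = gc a (- g).
Proof.
case: bar_A => barL barE.
pose f1 a := gc (bar a) g; pose f2 a := gc a (- g).
apply: (@form_ext _ _ _ _ eps_basis f1 f2) => [c x y|c x y|h]; rewrite /f1 /f2.
- by rewrite barL (coord_form eps_basis).
- exact: coord_form.
- by rewrite barE !coord_basis eqr_oppLR.
Qed.

(** Membership in [A_{<0}], read off the coordinates. *)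
Definition negative a := forall g, gc a g <> 0 -> g < 0.

Lemma negative0 : negative 0.
Proof. by move=> g; rewrite (form0 (coord_form eps_basis g)). Qed.

Lemma negativeB a b : negative a -> negative b -> negative (a - b).
Proof.
move=> an bn g; rewrite (formB _ _ (coord_form eps_basis g)) => ab.
have [a0|/eqP /an //] := eqVneq (gc a g) 0.
by apply: bn => b0; apply: ab; rewrite a0 b0 subrr.
Qed.

Lemma negative_int_span a : int_span eps [set g | g < 0] a -> negative a.
Proof.
move=> [c [cfin ->]] g gc0; apply: contrapT => gN; apply: gc0.
have -> : \sum_(h \in [set g | g < 0]) eps h *~ c h =
    \sum_(h \in [set g | g < 0]) ((c h)%:~R : R) *: eps h.
  by apply: eq_fsbigr => h _; rewrite scaler_int.
rewrite (form_fsum _ (coord_form eps_basis g)).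
  apply: fsbig1 => h /= hN; rewrite coord_basis.
  case: eqP => [hg|]; last by rewrite mulr0.
  by rewrite hg in hN.
apply: (sub_finite_set _ cfin) => h /= [hN ch]; split=> // ch0.
by apply: ch; rewrite ch0.
Qed.

Lemma ordN g : g < 0 -> ~ - g < 0.
Proof.
case: Gamma_ordered => _ compat g0 Ng0.
have := compat _ _ (- g) (ltW g0); rewrite subrr sub0r => ge0.
by have := le_lt_trans ge0 Ng0; rewrite ltxx.
Qed.

(** Bar-invariance puts [- g] in the support along with [g], and the two cannot both be negative. *)
Lemma negative_bar_eq0 a : negative a -> bar a = a -> a = 0.
Proof.
move=> an bara; apply: (@coord_inj _ _ _ _ eps_basis) => g.
rewrite (form0 (coord_form eps_basis g)); apply: contrapT => ag.
apply: (ordN (an _ ag)); apply: an.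
by rewrite -coord_bar bara.
Qed.

(* Compare leading coefficients. *)
Lemma eps_addN_reg g a : 0 < g -> (eps g + eps (- g)) * a = 0 -> a = 0.
Proof.
case: (Gamma_ordered) => total compat g0 ga.
have rec h : gc a h = - gc a (h + g + g).
  have := congr1 (gc ^~ (h + g)) ga.
  rewrite /= mulrDl (formD _ _ (coord_form eps_basis _)) !coord_eps_mul.
  rewrite (form0 (coord_form eps_basis _)) addrK opprK.
  by move/eqP; rewrite addr_eq0 => /eqP.
apply: (@coord_inj _ _ _ _ eps_basis) => h0.
rewrite (form0 (coord_form eps_basis h0)); apply: contrapT => ah0.
have [afin _] := coordP eps_basis a; rewrite setTI in afin.
have [|||h [ah hmax]] := @finite_maximal _ _ (fun g h : Gamma => g <= h) _ _ afin.
- by move=> i j; case/orP: (total i j); [left|right].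
- by move=> i j k; exact: le_trans.
- by exists h0.
have hg : h < h + g + g.
  have lth k : k < k + g.
    rewrite lt_neqAle; apply/andP; split.
      by rewrite -{1}[k]addr0 (inj_eq (addrI k)) eq_sym (gt_eqF g0).
    by have := compat _ _ k (ltW g0); rewrite add0r addrC.
  exact: lt_trans (lth h) (lth _).
have /hmax : gc a (h + g + g) <> 0 by move=> a0; apply: ah; rewrite rec a0 oppr0.
by move/(lt_le_trans hg); rewrite ltxx.
Qed.

End GroupRing.

(** * Hecke algebras *)

Section Hecke.
Variables (R : comNzRingType) (Gamma : porderZmodType) (W : groupType).
Variables (S : set W) (L : W -> Gamma) (A : comAlgType R) (eps : Gamma -> A).
Variables (H : algType A) (T : W -> H).
Hypotheses (Gamma_ordered : ordered_group Gamma) (WS : coxeter_system S).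
Hypotheses (AR : is_group_ring eps) (HT : is_hecke_algebra S L eps T).
Implicit Types (w x y z s : W) (h : H).
Local Notation l := (len S).
Local Notation xi s := (eps (L s) - eps (- L s)).

Lemma T_basis : is_basis T. Proof. by case: HT. Qed.
Local Notation tc := (coord T_basis).

Lemma T_1 : T 1%g = 1. Proof. by case: HT. Qed.

Lemma T_asc s w : S s -> (l w < l (s * w)%g)%N -> T s * T w = T (s * w)%g.
Proof. by case: HT => _ _ TA _; exact: TA. Qed.

Lemma T_desc s w : S s -> (l (s * w)%g < l w)%N ->
  T s * T w = T (s * w)%g + xi s *: T w.
Proof. by case: HT => _ _ _; apply. Qed.

Lemma T_gen_mul s w : S s ->
  T s * T w = T (s * w)%g + (if (l (s * w)%g < l w)%N then xi s else 0) *: T w.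
Proof.
move=> Ss; case: ifPn => [|/(len_incP WS Ss)]; first exact: T_desc.
by rewrite scale0r addr0; exact: T_asc.
Qed.

Lemma T_mul v w : l (v * w)%g = (l v + l w)%N -> T v * T w = T (v * w)%g.
Proof.
have := gen_all WS v; move: v.
apply: (gen_ind WS (@subset_refl _ S)) => [_|s v Ss _ lsv /= IHv lsvw].
  by rewrite T_1 mul1r mul1g.
have ls := len_gen WS Ss.
have lsvw' := len_mul WS s (v * w)%g; have lvw := len_mul WS v w.
have sE : (s * v * w)%g = (s * (v * w))%g by rewrite mulgA.
rewrite sE lsv in lsvw.
rewrite sE -(@T_asc s v) ?lsv // -(@T_asc s (v * w)%g) //; last by lia.
by rewrite -mulrA IHv //; lia.
Qed.

Lemma len_gen1 s : S s -> l s = 1%N.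
Proof.
move=> Ss; have := len_gen WS Ss; have [s1 _] := cox_order2 WS Ss.
by have : l s <> 0%N by [move/(len_eq0 WS)]; lia.
Qed.

Lemma T_sq s : S s -> T s * T s = 1 + xi s *: T s.
Proof.
move=> Ss; have [_ ss] := cox_order2 WS Ss.
by rewrite T_desc // ss ?T_1 // (len1 WS) len_gen1.
Qed.

Lemma coord_T_mul s h w : S s -> tc (T s * h) w =
  tc h (s * w)%g + (if (l (s * w)%g < l w)%N then xi s else 0) * tc h w.
Proof.
move=> Ss; pose f1 h := tc (T s * h) w.
pose f2 h := tc h (s * w)%g +
  (if (l (s * w)%g < l w)%N then xi s else 0) * tc h w.
apply: (@form_ext _ _ _ _ T_basis f1 f2) => [c x y|c x y|z]; rewrite /f1 /f2.
- by rewrite mulrDr -scalerAr (coord_form T_basis).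
- by rewrite !(coord_form T_basis) !mulrDr [in RHS]addrACA mulrCA.
- rewrite T_gen_mul // addrC (coord_form T_basis) !coord_basis addrC; congr (_ + _).
    have -> // : ((s * z)%g == w) = (z == (s * w)%g).
    by apply/eqP/eqP => [<-|->]; rewrite (coxK WS _ Ss).
  by case: eqP => [->//|_]; rewrite !mulr0.
Qed.

(** Additivity of lengths on the support of [h] means that [T x] merely translates the basis vectors
    occurring in [h]. *)
Lemma mul_T_coord x h w : (forall y, tc h y <> 0 -> l (x * y)%g = (l x + l y)%N) ->
  tc (T x * h) w = tc h (x^-1 * w)%g.
Proof.
move=> hx; have [r [_ _ hE]] := coord_seq T_basis h.
have := form_sum r xpredT (tc h) T (coord_form T_basis (x^-1 * w)%g).
rewrite -hE => ->; rewrite {1}hE mulr_sumr.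
have -> : \sum_(y <- r) T x * (tc h y *: T y) = \sum_(y <- r) tc h y *: T (x * y)%g.
  apply: eq_bigr => y _; have [->|/eqP /hx lxy] := eqVneq (tc h y) 0.
    by rewrite !scale0r mulr0.
  by rewrite -scalerAr T_mul.
rewrite (form_sum _ _ _ _ (coord_form T_basis w)); apply: eq_bigr => y _.
rewrite !coord_basis; congr (_ * (nat_of_bool _)%:R).
by apply/eqP/eqP => [<-|->]; rewrite ?mulKg ?mulVKg.
Qed.

(** * The bar involution and the uniqueness principle *)

Section Bar.
Variables (bar : A -> A) (barH : {rmorphism H -> H}).
Hypotheses (bar_A : is_group_ring_bar eps bar) (bar_H : is_hecke_bar bar T barH).

Lemma bar_T_gen s : S s -> barH (T s) = T s - xi s *: 1.
Proof.
move=> Ss; case: bar_H => _ _ barT Tbar.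
have TsV : T s * (T s - xi s *: 1) = 1.
  by rewrite mulrBr T_sq // -scalerAr mulr1 addrK.
have := barT s; rewrite (cox_inv WS Ss) => barTs.
by rewrite -[LHS]mulr1 -[in LHS]TsV mulrA barTs mul1r.
Qed.

(** Induction on length, multiplying by [barH (T s) = T s - xi s *: 1], which raises lengths by at
    most one. Triangularity by length is all that comparing leading coefficients requires. *)
Lemma bar_T_coord w : tc (barH (T w)) w = 1 /\
  forall y, tc (barH (T w)) y <> 0 -> y = w \/ (l y < l w)%N.
Proof.
have := gen_all WS w; move: w.
apply: (gen_ind WS (@subset_refl _ S)) => [|s w Ss _ lsw /= [IH1 IHw]].
  rewrite T_1 rmorph1 -T_1; split=> [|y]; rewrite coord_basis ?eqxx //.
  by case: eqP => [->|]; [left|].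
have coordE y : tc (barH (T (s * w)%g)) y = tc (barH (T w)) (s * y)%g +
    ((if (l (s * y)%g < l y)%N then xi s else 0) - xi s) * tc (barH (T w)) y.
  rewrite -T_asc ?lsw // rmorphM /= bar_T_gen // mulrBl -scalerAl mul1r.
  rewrite (formB _ _ (coord_form T_basis y)) coord_T_mul //.
  by rewrite (formZ _ _ (coord_form T_basis y)) [in RHS]mulrBl addrA.
rewrite !coordE (coxK WS _ Ss) IH1 lsw ltnSn subrr mul0r addr0; split=> // y.
rewrite coordE => yP; have ls := len_gen WS Ss.
have [c0|/eqP cy] := eqVneq (tc (barH (T w)) (s * y)%g) 0.
  right; have cy : tc (barH (T w)) y <> 0.
    by move=> cy; apply: yP; rewrite c0 cy mulr0 addr0.
  by have [->|] := IHw _ cy; lia.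
have [<-|lt] := IHw _ cy; first by left; rewrite (coxK WS _ Ss).
right; have := len_mul WS s (s * y)%g; rewrite (coxK WS _ Ss); lia.
Qed.

(** At an element of maximal length in the support of [h], triangularity of the bar involution makes
    the coefficient itself bar-invariant. Being negative, it is zero. *)
Lemma bar_invariant_eq0 h : barH h = h -> (forall w, negative AR (tc h w)) -> h = 0.
Proof.
move=> barh hneg; case: bar_H => _ barHZ _ _.
apply: (@coord_inj _ _ _ _ T_basis) => w0.
rewrite (form0 (coord_form T_basis w0)); apply: contrapT => hw0.
have [hfin _] := coordP T_basis h; rewrite setTI in hfin.
have [|||w [hw wmax]] := @finite_maximal _ _ (fun v w => (l v <= l w)%N) _ _ hfin.
- by move=> i j; case: (leqP (l i) (l j)); [left|move/ltnW; right].
- by move=> i j k; exact: leq_trans.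
- by exists w0.
apply: (hw); apply: (negative_bar_eq0 Gamma_ordered bar_A (hneg w)).
have [r [r_uniq hr hE]] := coord_seq T_basis h.
rewrite -{2}barh {2}hE rmorph_sum /=.
under [in RHS]eq_bigr => y _ do rewrite barHZ.
rewrite (form_sum _ _ _ _ (coord_form T_basis w)) (bigD1_seq w) ?hr //=.
rewrite (bar_T_coord w).1 mulr1 big1 ?addr0 // => y yw.
have [->|/eqP hy] := eqVneq (tc h y) 0.
  have -> : bar 0 = 0.
    case: bar_A => barL _; have := barL (-1) 0 0.
    by rewrite !scaleN1r oppr0 addr0 addNr.
  by rewrite mul0r.
have [->|/eqP cw] := eqVneq (tc (barH (T y)) w) 0; first by rewrite mulr0.
have [wy|] := (bar_T_coord y).2 w cw; first by rewrite wy eqxx in yw.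
by rewrite ltnNge wmax.
Qed.

End Bar.

End Hecke.

(** * Kazhdan-Lusztig bases *)

Section KazhdanLusztig.
Variables (R : comNzRingType) (Gamma : porderZmodType) (W : groupType).
Variables (S : set W) (L : W -> Gamma) (A : comAlgType R) (eps : Gamma -> A).
Variables (H : algType A) (T : W -> H).
Variables (bar : A -> A) (barH : {rmorphism H -> H}) (C : W -> H).
Variable M : W -> W -> W -> A.
Hypotheses (Gamma_ordered : ordered_group Gamma).
Hypotheses (S_finite : finite_set S) (WS : coxeter_system S).
Hypotheses (AR : is_group_ring eps) (bar_A : is_group_ring_bar eps bar).
Hypotheses (HT : is_hecke_algebra S L eps T) (bar_H : is_hecke_bar bar T barH).
Hypotheses (C_KL : is_KL_basis S eps T barH C) (M_KL : is_KL_M S L eps T C M).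
Implicit Types (s t u v w x y z : W) (h : H).
Local Notation l := (len S).
Local Notation tc := (coord (T_basis HT)).

Lemma bar_C w : barH (C w) = C w. Proof. by case: (C_KL w). Qed.

Lemma C_coord w : [/\ tc (C w) w = 1,
  forall y, y <> w -> negative AR (tc (C w) y) &
  forall y, tc (C w) y <> 0 -> bruhat_le S y w].
Proof.
have [_ [P [CP P1 Pneg P0]]] := C_KL w.
rewrite (coord_uniq _ CP); split=> // y.
  by move=> /Pneg; exact: negative_int_span.
by move=> Py; apply: contrapT => /P0.
Qed.

Lemma M_range_finite s w :
  finite_set [set y | bruhat_lt S (s * y)%g y /\ bruhat_lt S y w].
Proof.
apply: (sub_finite_set _ (finite_len_le WS (l w) S_finite)) => y /= [_].
by move=> /bruhat_lt_len/ltnW.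
Qed.

(** When [L s = 0] the quadratic term disappears: [T s] is bar-invariant and permutes coordinates by
    [w |-> s * w]. So [T s * C w - C (s * w)] is bar-invariant, and all its coordinates are negative
    because the two leading terms cancel. *)
Lemma T_C_eq0 s w : S s -> L s = 0 -> T s * C w = C (s * w)%g.
Proof.
move=> Ss Ls0; apply/eqP; rewrite -subr_eq0; apply/eqP.
have xi0 : eps (L s) - eps (- L s) = 0 by rewrite Ls0 oppr0 subrr.
apply: (bar_invariant_eq0 Gamma_ordered WS bar_A bar_H (AR := AR) (HT := HT)).
  by rewrite rmorphB rmorphM /= !bar_C (bar_T_gen WS HT bar_H Ss) xi0 scale0r subr0.
move=> y; rewrite (formB _ _ (coord_form (T_basis HT) y)) (coord_T_mul WS HT) // xi0.
rewrite if_same mul0r addr0.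
have [Cw1 Cwneg _] := C_coord w; have [Csw1 Cswneg _] := C_coord (s * w)%g.
have [->|/eqP ysw] := eqVneq y (s * w)%g.
  rewrite (coxK WS _ Ss) Cw1 Csw1 subrr; exact: negative0.
apply: negativeB; last exact: Cswneg.
by apply: Cwneg => syw; apply: ysw; rewrite -syw (coxK WS _ Ss).
Qed.

Lemma T_C_asc s w : S s -> 0 < L s -> (l w < l (s * w)%g)%N ->
  T s * C w = C (s * w)%g - eps (- L s) *: C w
    + \sum_(y \in [set y | bruhat_lt S (s * y)%g y /\ bruhat_lt S y w])
        M s y w *: C y.
Proof. by move=> Ss Ls /(bruhat_gtP _ Ss) /(M_KL Ss Ls)[]. Qed.

(** The expansion for [s * w] gives [C w = (T s + eps (- L s)) * C (s * w) - Q], where [Q] involves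
    only shorter [C y] with [s * y < y]. The quadratic relation makes [T s + eps (- L s)] an
    eigenvector of [T s] for [eps (L s)], and induction does the same for [Q]. *)
Lemma T_C_desc s w : S s -> 0 < L s -> (l (s * w)%g < l w)%N ->
  T s * C w = eps (L s) *: C w.
Proof.
move=> Ss Ls; move: {2}(l w).+1 (ltnSn (l w)) => n.
elim: n w => // n IHn w lwn sww.
set D := [set y | bruhat_lt S (s * y)%g y /\ bruhat_lt S y (s * w)%g].
have Dfin : finite_set D by exact: M_range_finite.
set Q := \sum_(y \in D) M s y (s * w)%g *: C y.
have TQ : T s * Q = eps (L s) *: Q.
  rewrite /Q !fsbig_finite // mulr_sumr scaler_sumr; apply: eq_big_seq => y.
  rewrite in_fset_set // inE => -[/(bruhat_ltP WS _ Ss) sy /bruhat_lt_len yw].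
  rewrite -scalerAr IHn ?scalerA 1?mulrC //.
  by apply: leq_trans yw _; rewrite -ltnS; apply: leq_trans lwn; exact: ltnW.
have TC : T s * C (s * w)%g = C w - eps (- L s) *: C (s * w)%g + Q.
  by rewrite T_C_asc // (coxK WS _ Ss).
have -> : C w = T s * C (s * w)%g + eps (- L s) *: C (s * w)%g - Q.
  by rewrite TC addrAC addrK subrK.
rewrite mulrBr TQ mulrDr mulrA (T_sq WS HT Ss) mulrDl mul1r -scalerAr -scalerAl.
rewrite scalerBr scalerDr scalerA (eps_mulN AR) scale1r scalerBl.
by rewrite -[X in X - _]addrA subrK [C _ + _]addrC.
Qed.

(** * The basis of the [T x * C u] and the action of [T s] on it *)

Section Relative.
Variable S' : set W.
Hypothesis S'S : S' `<=` S.
Local Notation W' := (gen_subgroup S').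
Local Notation X := (min_coset_reps S S').

Definition coset_split w : W * W := sval (cid (coset_ex S S' w)).

Lemma coset_splitP x u : X x -> W' u -> coset_split (x * u)%g = (x, u).
Proof.
move=> Xx W'u; rewrite /coset_split; case: cid => -[z v] /= [Xz W'v E].
by have [-> ->] := coset_uniq WS S'S Xx Xz W'u W'v E.
Qed.

(* For [w = xu] this is [T_x C_u]. *)
Definition mixed_basis w : H := T (coset_split w).1 * C (coset_split w).2.

Lemma mixed_basisE x u : X x -> W' u -> mixed_basis (x * u)%g = T x * C u.
Proof. by move=> Xx W'u; rewrite /mixed_basis coset_splitP. Qed.

(** [C u] is supported in [W'], where lengths add after multiplication by [x]. *)
Lemma TC_coord x u w : X x -> W' u ->
  tc (T x * C u) w = tc (C u) (x^-1 * w)%g.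
Proof.
move=> Xx W'u; apply: (mul_T_coord WS) => y; have [_ _ Cu] := C_coord u.
move=> /Cu yu; apply: (coset_len WS S'S) => //.
exact: (bruhat_gen WS S'S W'u yu).
Qed.

Lemma mixed_basisP : is_basis mixed_basis.
Proof.
apply: (@triangular_basis _ _ _ _ (T_basis HT) l) => w;
  have [[x u] /= [Xx W'u ->]] := coset_ex S S' w;
  rewrite mixed_basisE // ?TC_coord // ?mulKg.
  by case: (C_coord u).
move=> z; rewrite TC_coord //; have [_ _ Cu] := C_coord u => /Cu zu.
have W'z := bruhat_gen WS S'S W'u zu.
have -> : z = (x * (x^-1 * z))%g by rewrite mulVKg.
have [->|lt] := bruhat_le_len zu; [by left|right].
by rewrite (coset_len WS S'S Xx W'z) (coset_len WS S'S Xx W'u) ltn_add2l.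
Qed.

Local Notation kap := (coord mixed_basisP).

Lemma kap_TC x u w : X x -> W' u -> kap (T x * C u) w = ((x * u)%g == w)%:R.
Proof. by move=> Xx W'u; rewrite -mixed_basisE // coord_basis. Qed.

Lemma coset_eq x x' u u' : X x -> X x' -> W' u -> W' u' ->
  ((x * u)%g == (x' * u')%g) = (x == x') && (u == u').
Proof.
move=> Xx Xx' W'u W'u'; apply/eqP/andP => [E|[/eqP -> /eqP ->] //].
by have [-> ->] := coset_uniq WS S'S Xx Xx' W'u W'u' E; rewrite !eqxx.
Qed.

(** [T x' * C u'] is [T (x' * u')] plus multiples of [T (x' * y)] with [y] in [W'] shorter than
    [u']. By induction [T (x' * u')] thus involves only basis vectors with first factor [T x']. *)
Lemma kap_T_eq0 x x' u u' : X x -> X x' -> W' u -> W' u' -> x <> x' ->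
  kap (T (x' * u')%g) (x * u)%g = 0.
Proof.
move=> Xx Xx' W'u + xx'; move: {2}(l u').+1 (ltnSn (l u')) => n.
elim: n u' => // n IHn u' lun W'u'.
have := kap_TC (x * u)%g Xx' W'u'.
rewrite coset_eq // eq_sym (negPf (introN eqP xx')) /=.
have [r [r_uniq Cr CE]] := coord_seq (T_basis HT) (C u').
have [Cu1 _ Cle] := C_coord u'.
have u'r : u' \in r by apply: Cr; rewrite Cu1; exact/eqP/oner_neq0.
have -> : T x' * C u' = \sum_(y <- r) tc (C u') y *: (T x' * T y).
  by rewrite {1}CE mulr_sumr; apply: eq_bigr => y _; rewrite -scalerAr.
rewrite (form_sum _ _ _ _ (coord_form mixed_basisP (x * u)%g)) (bigD1_seq u') //=.
rewrite Cu1 mul1r (T_mul WS HT) ?(coset_len WS S'S) // big1 ?addr0 // => y yu'.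
have [->|/eqP /Cle yle] := eqVneq (tc (C u') y) 0; first by rewrite mul0r.
have W'y := bruhat_gen WS S'S W'u' yle.
rewrite (T_mul WS HT) ?(coset_len WS S'S) // IHn ?mulr0 //.
have [yE|ylt] := bruhat_le_len yle; first by rewrite yE eqxx in yu'.
exact: leq_trans ylt _.
Qed.

(** Supplies the bound [x <= z] in [ptilde]. Some [T y] occurring in [C (z * v)] has a nonzero
    coordinate at [x * u], so [y] has representative [x]; as [y] is below [z * v], projecting to
    representatives gives the claim. *)
Lemma kap_C_support x u z v : X x -> X z -> W' u -> W' v ->
  kap (C (z * v)%g) (x * u)%g <> 0 -> bruhat_le S x z.
Proof.
move=> Xx Xz W'u W'v.
move=> /(form_expand (T_basis HT) (coord_form mixed_basisP (x * u)%g))[y [Cy Ty]].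
have [[x' u'] /= [Xx' W'u' yE]] := coset_ex S S' y.
have xE : x = x'.
  by apply: contrapT => xx'; apply: Ty; rewrite yE kap_T_eq0.
have [_ _ Cle] := C_coord (z * v)%g.
by apply: (bruhat_coset WS S'S Xx Xz W'u' W'v); rewrite xE -yE; exact: Cle.
Qed.


Lemma kap_T_mul_eq0 x x' u h : X x -> X x' -> W' u ->
  (forall y, tc h y <> 0 -> W' y) -> x <> x' -> kap (T x' * h) (x * u)%g = 0.
Proof.
move=> Xx Xx' W'u hW' xx'; have [r [_ _ hE]] := coord_seq (T_basis HT) h.
have -> : T x' * h = \sum_(y <- r) tc h y *: (T x' * T y).
  by rewrite {1}hE mulr_sumr; apply: eq_bigr => y _; rewrite -scalerAr.
rewrite (form_sum _ _ _ _ (coord_form mixed_basisP (x * u)%g)) big1 // => y _.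
have [->|/eqP /hW' W'y] := eqVneq (tc h y) 0; first by rewrite mul0r.
by rewrite (T_mul WS HT) ?(coset_len WS S'S) // kap_T_eq0 ?mulr0.
Qed.

Lemma T_C_support t u y : S' t -> W' u -> tc (T t * C u) y <> 0 -> W' y.
Proof.
move=> S't W'u; rewrite (coord_T_mul WS HT); last exact: S'S.
have [_ _ Cle] := C_coord u.
have [->|/eqP /Cle ty] := eqVneq (tc (C u) (t * y)%g) 0.
  have [->|/eqP /Cle yu] := eqVneq (tc (C u) y) 0; first by rewrite mulr0 addr0.
  by move=> _; exact: (bruhat_gen WS S'S W'u yu).
move=> _; rewrite -(coxK WS y (S'S S't)); apply: genM; first exact: sub_gen.
exact: (bruhat_gen WS S'S W'u ty).
Qed.

Lemma T_TC s x u : S s -> T s * (T x * C u) = T (s * x)%g * C u +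
  (if (l (s * x)%g < l x)%N then eps (L s) - eps (- L s) else 0) *: (T x * C u).
Proof. by move=> Ss; rewrite mulrA (T_gen_mul WS HT _ Ss) mulrDl -scalerAl. Qed.

Lemma T_TC_stable s x u : S s -> X x -> ~ X (s * x)%g ->
  T s * (T x * C u) = T x * (T (x^-1 * s * x)%g * C u).
Proof.
move=> Ss Xx XNsx; have S't := rep_asc WS S'S Xx Ss XNsx.
have sxE : (s * x = x * (x^-1 * s * x))%g by rewrite !mulgA mulgV mul1g.
rewrite !mulrA (T_mul WS HT (w := (x^-1 * s * x)%g)) -?sxE.
  rewrite (T_asc HT) //; apply: (len_incP WS) => //.
  by apply/negP => /(rep_desc WS S'S Xx Ss).
by rewrite {1}sxE (coset_len WS S'S) //; exact: sub_gen.
Qed.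

(** Only basis vectors with first factor [T x] or [T (s * x)] contribute: if [s * x'] is not in [X],
    then [T s] keeps the span of the [T x' * C u'], and such an [x'] differs from both [x] and
    [s * x]. *)
Lemma kap_T_move s x u h : S s -> X x -> X (s * x)%g -> W' u ->
  kap (T s * h) (x * u)%g = kap h (s * x * u)%g +
    (if (l (s * x)%g < l x)%N then eps (L s) - eps (- L s) else 0) *
    kap h (x * u)%g.
Proof.
move=> Ss Xx Xsx W'u; set c := if _ then _ else _.
pose f1 h := kap (T s * h) (x * u)%g.
pose f2 h := kap h (s * x * u)%g + c * kap h (x * u)%g.
apply: (@form_ext _ _ _ _ mixed_basisP f1 f2) => [a y z|a y z|b]; rewrite /f1 /f2.
- by rewrite mulrDr -scalerAr (coord_form mixed_basisP).
- by rewrite !(coord_form mixed_basisP) !mulrDr [in RHS]addrACA [c * (a * _)]mulrCA.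
have [[x' u'] /= [Xx' W'u' ->]] := coset_ex S S' b.
rewrite mixed_basisE // !kap_TC // !coset_eq //.
have [Xsx'|XNsx'] := pselect (X (s * x')%g).
  rewrite T_TC // (formD _ _ (coord_form mixed_basisP _)).
  rewrite (formZ _ _ (coord_form mixed_basisP _)) !kap_TC // !coset_eq //.
  have -> : ((s * x')%g == x) = (x' == (s * x)%g).
    by apply/eqP/eqP => [<-|->]; rewrite (coxK WS _ Ss).
  by case: (eqVneq x' x) => [->//|_]; rewrite !mulr0.
rewrite T_TC_stable //.
rewrite kap_T_mul_eq0 //; last by move=> xx'; apply: XNsx'; rewrite -xx'.
  case: (eqVneq x' (s * x)%g) => [x'E|_].
    by case: XNsx'; rewrite x'E (coxK WS _ Ss).
  case: (eqVneq x' x) => [x'E|_]; first by case: XNsx'; rewrite x'E.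
  by rewrite mulr0 addr0.
by move=> y; apply: T_C_support => //; exact: (rep_asc WS S'S Xx' Ss).
Qed.

(** * The action of [T s] when [s * x] is not in [X] *)

Section Stable.
Variables (s x u : W).
Hypotheses (Ss : S s) (Xx : X x) (XNsx : ~ X (s * x)%g) (W'u : W' u).
Let t := (x^-1 * s * x)%g.

Lemma stable_gen : S' t. Proof. exact: (rep_asc WS S'S Xx Ss XNsx). Qed.
Let S't : S' t := stable_gen.
Let St : S t. Proof. exact: S'S. Qed.
Let W't : W' t. Proof. exact: sub_gen. Qed.

(** Isolates the block of [x]: no other [x'] contributes, since [s * x' = x] would put [s * x = x']
    in [X]. Within the block, [T s] acts as [T t] on the second factor. *)
Lemma kap_T_stable_ext (f : H -> A) : is_form f ->
  (forall x' u', X x' -> W' u' -> x' <> x -> f (T x' * C u') = 0) ->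
  (forall u', W' u' -> f (T x * C u') = kap (T x * (T t * C u')) (x * u)%g) ->
  forall h, kap (T s * h) (x * u)%g = f h.
Proof.
move=> f_form f_other f_x; pose f1 h := kap (T s * h) (x * u)%g.
apply: (@form_ext _ _ _ _ mixed_basisP f1 f) => [a y z|//|b]; rewrite /f1.
  by rewrite mulrDr -scalerAr (coord_form mixed_basisP).
have [[x' u'] /= [Xx' W'u' ->]] := coset_ex S S' b; rewrite mixed_basisE //.
have [->|/eqP x'x] := eqVneq x' x; first by rewrite f_x // T_TC_stable.
rewrite f_other //; have [Xsx'|XNsx'] := pselect (X (s * x')%g).
  rewrite T_TC // (formD _ _ (coord_form mixed_basisP _)).
  rewrite (formZ _ _ (coord_form mixed_basisP _)) !kap_TC // !coset_eq //.
  case: (eqVneq (s * x')%g x) => [sx'|_].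
    by case: XNsx; rewrite -sx' (coxK WS _ Ss).
  by rewrite (introF eqP x'x) mulr0 addr0.
rewrite T_TC_stable // kap_T_mul_eq0 //; last by move=> xx'; case: x'x.
by move=> y; apply: T_C_support => //; exact: (rep_asc WS S'S Xx' Ss).
Qed.

Lemma kap_T_stable_eq0 h : L s = 0 -> L t = L s ->
  kap (T s * h) (x * u)%g = kap h (x * t * u)%g.
Proof.
move=> Ls0 Lt; have W'tu : W' (t * u)%g by exact: genM.
have xtu : (x * t * u = x * (t * u))%g by exact: (esym (mulgA x t u)).
rewrite xtu; apply: (kap_T_stable_ext (coord_form mixed_basisP (x * (t * u))%g)).
  move=> x' u' Xx' W'u' /eqP/negPf x'x.
  by rewrite kap_TC // coset_eq // x'x.
move=> u' W'u'; rewrite (T_C_eq0 _ St) ?Lt // !kap_TC //; last exact: genM.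
rewrite !coset_eq // ?eqxx /=; last exact: genM.
by congr (nat_of_bool _)%:R; apply/eqP/eqP => [->|<-]; rewrite (coxK WS _ St).
Qed.

Lemma kap_T_desc u' : 0 < L t -> W' u' -> (l (t * u')%g < l u')%N ->
  kap (T x * (T t * C u')) (x * u)%g = eps (L t) * (u' == u)%:R.
Proof.
move=> Lt W'u' tu'; rewrite (T_C_desc St) // -scalerAr.
rewrite (formZ _ _ (coord_form mixed_basisP _)) kap_TC // coset_eq // eqxx.
by [].
Qed.

Lemma kap_T_asc u' : 0 < L t -> W' u' -> (l u' < l (t * u')%g)%N ->
  kap (T x * (T t * C u')) (x * u)%g =
  ((t * u')%g == u)%:R - eps (- L t) * (u' == u)%:R +
  if `[< bruhat_lt S (t * u)%g u /\ bruhat_lt S u u' >] then M t u u' else 0.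
Proof.
move=> Lt W'u' tu'; rewrite (T_C_asc St) //; set D := [set y | _].
pose f h := kap (T x * h) (x * u)%g.
have fP : is_form f.
  by move=> a h k; rewrite /f mulrDr -scalerAr (coord_form mixed_basisP).
have fC y : W' y -> f (C y) = (y == u)%:R.
  by move=> W'y; rewrite /f kap_TC // coset_eq // eqxx.
rewrite -/(f _) (formD _ _ fP) (formB _ _ fP) (formZ _ _ fP) !fC //; last exact: genM.
congr (_ + _).
have Dfin : finite_set (D `&` [set y | M t y u' <> 0]).
  by apply: (sub_finite_set _ (M_range_finite t u')) => y [].
rewrite (form_fsum _ fP Dfin).
(* The sum defining [M t] ranges over [W], but elements below [u'] stay in [W']. *)
have DW' y : D y -> W' y by move=> [_ [yu' _]]; exact: (bruhat_gen WS S'S W'u' yu').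
case: asboolP => [Du|Du].
  rewrite (@fsum_single _ _ D _ u) ?fC ?eqxx ?mulr1 // => y Dy yu.
  by rewrite fC ?(negPf (introN eqP yu)) ?mulr0 //; exact: DW'.
apply: fsbig1 => y Dy; rewrite fC; last exact: DW'.
by case: eqP => [yu|]; rewrite ?mulr0 //; case: Du; rewrite -yu.
Qed.

(** For [u < tu], the vector [C u] occurs in [T t * C u'] only when [u' = u]: the vectors added by
    the [M]-sum have [t] as a descent, and so does [C (t * u')] when [u' < tu']. *)
Lemma kap_T_stable_up h : 0 < L s -> L t = L s -> (l u < l (t * u)%g)%N ->
  kap (T s * h) (x * u)%g = - eps (- L s) * kap h (x * u)%g.
Proof.
move=> Ls Lt utu; pose f h := - eps (- L s) * kap h (x * u)%g.
have fP : is_form f.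
  by move=> a y z; rewrite /f (coord_form mixed_basisP) mulrDr mulrCA.
apply: (kap_T_stable_ext fP) => [x' u' Xx' W'u' /eqP/negPf x'x|u' W'u']; rewrite /f.
  by rewrite kap_TC // coset_eq // x'x mulr0.
rewrite kap_TC // coset_eq // eqxx /=.
have [tu'|/(len_incP WS St) tu'] := boolP (l (t * u')%g < l u')%N.
  rewrite kap_T_desc ?Lt //; case: eqP => [u'u|]; last by rewrite !mulr0.
  by move: tu'; rewrite u'u ltnNge (ltnW utu).
rewrite kap_T_asc ?Lt // ifF; last first.
  apply/asboolP => -[/bruhat_lt_len tu _].
  by move: tu; rewrite ltnNge (ltnW utu).
case: (eqVneq (t * u')%g u) => [tu'u|_]; last by rewrite sub0r addr0 mulNr.
by move: utu tu'; rewrite -tu'u (coxK WS _ St) => /ltnW; rewrite leqNgt => /negPf ->.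
Qed.

(** Collects the [u'] for which [C u] occurs in [T t * C u']: [u] itself with coefficient
    [eps (L s)], [t * u] with coefficient 1, and the [w > u] with [w < tw], with coefficient
    [M t u w]. *)
Lemma kap_T_stable_down h : 0 < L s -> L t = L s -> (l (t * u)%g < l u)%N ->
  kap (T s * h) (x * u)%g =
  eps (L s) * kap h (x * u)%g + kap h (x * t * u)%g +
  \sum_(w \in [set w | [/\ W' w, bruhat_lt S u w & bruhat_lt S w (t * w)%g]])
    M t u w * kap h (x * w)%g.
Proof.
move=> Ls Lt tuu; set D := [set w | _]; have W'tu : W' (t * u)%g by exact: genM.
have xtu : (x * t * u = x * (t * u))%g by exact: (esym (mulgA x t u)).
pose F h := \sum_(w \in D) M t u w * kap h (x * w)%g.
have FP : is_form F by apply: is_form_fsum; exact: mulgI.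
pose f h := eps (L s) * kap h (x * u)%g + (kap h (x * (t * u))%g + F h).
have fP : is_form f.
  apply: form_lincomb; first exact: coord_form.
  by move=> a y z; rewrite (coord_form mixed_basisP) FP mulrDr addrACA.
rewrite xtu -addrA -/(F h) -/(f h).
apply: (kap_T_stable_ext fP) => [x' u' Xx' W'u' /eqP/negPf x'x|u' W'u']; rewrite /f.
  rewrite !kap_TC // !coset_eq // x'x mulr0 !add0r.
  by apply: fsbig1 => w [W'w _ _]; rewrite kap_TC // coset_eq // x'x mulr0.
rewrite !kap_TC // !coset_eq // eqxx /=.
have FE : F (T x * C u') = if `[< D u' >] then M t u u' else 0.
  have FxE w : W' w -> M t u w * kap (T x * C u') (x * w)%g = M t u w * (u' == w)%:R.
    by move=> W'w; rewrite kap_TC // coset_eq // eqxx.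
  case: asboolP => [Du'|Du'].
    rewrite /F (@fsum_single _ _ D _ u') ?FxE ?eqxx ?mulr1 // => w [W'w _ _] wu'.
    by rewrite FxE // eq_sym (negPf (introN eqP wu')) mulr0.
  apply: fsbig1 => w Dw; have [W'w _ _] := Dw; rewrite FxE //.
  by case: eqP => [u'w|]; rewrite ?mulr0 //; case: Du'; rewrite u'w.
rewrite FE; have [tu'|/(len_incP WS St) tu'] := boolP (l (t * u')%g < l u')%N.
  rewrite kap_T_desc ?Lt // ifF; last first.
    apply/asboolP => -[_ _ /bruhat_lt_len]; rewrite ltnNge => /negP; apply.
    exact: ltnW.
  case: (eqVneq u' (t * u)%g) => [u'E|_]; last by rewrite !addr0.
  by move: tu'; rewrite u'E (coxK WS _ St) ltnNge (ltnW tuu).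
rewrite kap_T_asc ?Lt //; case: (eqVneq u' u) => [u'u|_].
  by move: tu'; rewrite u'u ltnNge (ltnW tuu).
rewrite !mulr0 subr0 add0r; congr (_ + _).
  by congr (nat_of_bool _)%:R; apply/eqP/eqP => [->|<-]; rewrite (coxK WS _ St).
congr (if _ then _ else _); apply/asbool_equiv_eq; split=> [[_ uu' _]|[_ uu']].
  by split=> //; apply/(bruhat_ltP WS _ St).
by split=> //; apply/(bruhat_gtP _ St).
Qed.

End Stable.

(** * Relative Kazhdan-Lusztig polynomials as coordinates *)

Section Coefficients.
Variable p : W -> W -> A.
Hypothesis p_KL : is_relative_KL S S' T C p.

Lemma p_kap x u y v : X x -> X y -> W' u -> W' v ->
  p (x * u)%g (y * v)%g = kap (C (y * v)%g) (x * u)%g.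
Proof.
move=> Xx Xy W'u W'v; have [pfin ->] := p_KL Xy W'v.
rewrite (form_fsum _ (coord_form mixed_basisP (x * u)%g) pfin).
rewrite (@fsum_single _ _ _ _ (x, u)) /=; [|by []|].
  by rewrite kap_TC // eqxx mulr1.
move=> [x' u'] /= [Xx' W'u'] ne; rewrite kap_TC // coset_eq //.
by case: eqP => [xE|]; case: eqP => [uE|]; rewrite ?mulr0 //; case: ne; rewrite xE uE.
Qed.

(** Both bounds on [z] are harmless: [z <= sy] follows from [zw < syv] by projection to
    representatives, and the terms without [x <= z] vanish by [kap_C_support]. *)
Lemma ptildeE s x u y v : X x -> W' u -> X (s * y)%g -> W' v ->
  ptilde S S' M p s x u y v =
  \sum_(z \in [set z | bruhat_lt S (s * z)%g z /\ bruhat_lt S z (s * y * v)%g])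
    M s z (s * y * v)%g * kap (C z) (x * u)%g.
Proof.
move=> Xx W'u Xsy W'v; rewrite /ptilde; set Q := [set zw | _]; set D := [set z | _].
pose F z := p (x * u)%g z * M s z (s * y * v)%g.
have <- : \sum_(z \in [set (zw.1 * zw.2)%g | zw in Q]) F z =
    \sum_(zw \in Q) F (zw.1 * zw.2)%g.
  apply: fsbig_image => -[z w] [z' w'] /set_mem [Xz W'w _ _] /set_mem [Xz' W'w' _ _] /= E.
  by have [/= -> ->] := coset_uniq WS S'S Xz Xz' W'w W'w' E.
have FE z : F z = M s z (s * y * v)%g * kap (C z) (x * u)%g.
  have [[z1 w1] /= [Xz1 W'w1 ->]] := coset_ex S S' z.
  by rewrite /F p_kap // mulrC.
rewrite (@fsbig_widen _ _ _ _ _ D); first by apply: eq_fsbigr => z _.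
  move=> _ [[z w] [/= Xz W'w [xz zsy] [szw zwv]] <-]; split=> //.
  by rewrite mulgA.
move=> z [Dz Qz]; rewrite /= FE; apply: contrapT => Fz; apply: Qz.
have [[z1 w1] /= [Xz1 W'w1 zE]] := coset_ex S S' z.
rewrite zE in Dz Fz *; case: Dz => szz zv.
exists (z1, w1) => //; split=> //=; last by rewrite -mulgA.
split; last by apply: (bruhat_coset WS S'S Xz1 Xsy W'w1 W'v); case: zv.
apply: (kap_C_support Xx Xz1 W'u W'w1) => k0.
by apply: Fz; rewrite k0 mulr0.
Qed.

Lemma p_unit x u v : X x -> W' u -> W' v ->
  p (x * u)%g v = ((x == 1%g) && (u == v))%:R.
Proof.
move=> Xx W'u W'v; have X1 : X 1%g by exact: min_coset_reps1.
rewrite -{1}[v]mul1g p_kap // mul1g -[C v]mul1r -(T_1 HT) kap_TC //.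
by rewrite coset_eq // eq_sym [v == u]eq_sym.
Qed.

(** * The recursion, case by case *)

Section Recursion.
Variables (s x y u v : W).
Hypotheses (Ss : S s) (Xx : X x) (Xy : X y) (W'u : W' u) (W'v : W' v).
Hypothesis sy : (l (s * y)%g < l y)%N.

Lemma desc_rep : X (s * y)%g. Proof. exact: (rep_desc WS S'S). Qed.
Let Xsy : X (s * y)%g := desc_rep.

Let yvE : (y * v)%g = (s * (s * y * v))%g.
Proof. by rewrite -[(s * y * v)%g]mulgA (coxK WS _ Ss). Qed.

Let syv : (l (s * y * v)%g < l (s * (s * y * v))%g)%N.
Proof.
by rewrite -yvE (coset_len WS S'S Xsy W'v) (coset_len WS S'S Xy W'v) ltn_add2r.
Qed.

Lemma C_recursion : 0 < L s ->
  p (x * u)%g (y * v)%g = kap (T s * C (s * y * v)%g) (x * u)%g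
    + eps (- L s) * p (x * u)%g (s * y * v)%g - ptilde S S' M p s x u y v.
Proof.
move=> Ls; rewrite !p_kap // ptildeE //; set w := (s * y * v)%g.
have := T_C_asc Ss Ls syv; rewrite -yvE -/w; set D := [set z | _] => TC.
have fP := coord_form mixed_basisP (x * u)%g.
rewrite TC (formD _ _ fP) (formB _ _ fP) (formZ _ _ fP) (form_fsum _ fP).
  by rewrite addrAC addrK subrK.
by apply: (sub_finite_set _ (M_range_finite s w)) => z [].
Qed.

Lemma p_eq0_move : L s = 0 -> X (s * x)%g ->
  p (x * u)%g (y * v)%g = p (s * x * u)%g (s * y * v)%g.
Proof.
move=> Ls Xsx; rewrite !p_kap // yvE -T_C_eq0 // kap_T_move //.
by rewrite Ls oppr0 subrr if_same mul0r addr0.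
Qed.

(** The factor [eps (L s) - eps (- L s)] from [kap_T_move] and the [eps (- L s)] of [C_recursion]
    add up to [eps (L s)]. *)
Lemma p_desc : 0 < L s -> (l (s * x)%g < l x)%N ->
  p (x * u)%g (y * v)%g = p (s * x * u)%g (s * y * v)%g
    + eps (L s) * p (x * u)%g (s * y * v)%g - ptilde S S' M p s x u y v.
Proof.
move=> Ls sx; have Xsx : X (s * x)%g by exact: (rep_desc WS S'S).
rewrite C_recursion // kap_T_move // sx !p_kap // mulrBl.
by rewrite addrA subrK.
Qed.

(** Compares the coordinates of [T s * C (y * v) = eps (L s) *: C (y * v)] at [s * x * u], where [s]
    is a descent of [s * x]. *)
Lemma p_asc : 0 < L s -> (l x < l (s * x)%g)%N -> X (s * x)%g ->
  p (x * u)%g (y * v)%g = eps (- L s) * p (s * x * u)%g (y * v)%g.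
Proof.
move=> Ls sx Xsx; rewrite !p_kap //.
have TC : T s * C (y * v)%g = eps (L s) *: C (y * v)%g.
  by apply: T_C_desc => //; rewrite yvE (coxK WS _ Ss).
have := kap_T_move (C (y * v)%g) Ss Xsx; rewrite (coxK WS _ Ss) => /(_ u Xx W'u).
rewrite sx TC (formZ _ _ (coord_form mixed_basisP _)) mulrBl addrCA => E.
apply/eqP; rewrite -subr_eq0; apply/eqP.
by apply: (addrI (eps (L s) * kap (C (y * v)%g) (s * x * u)%g)); rewrite addr0 -E.
Qed.

Section StableCase.
Hypothesis XNsx : ~ X (s * x)%g.
Let t := (x^-1 * s * x)%g.
Hypothesis Lt : L t = L s.

Lemma p_stable_eq0 : L s = 0 ->
  p (x * u)%g (y * v)%g = p (x * t * u)%g (s * y * v)%g.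
Proof.
move=> Ls; have W'tu : W' (t * u)%g.
  by apply: genM => //; apply: sub_gen; exact: stable_gen.
rewrite -[(x * t * u)%g](mulgA x t u) !p_kap // (mulgA x t u).
by rewrite yvE -T_C_eq0 // kap_T_stable_eq0.
Qed.

Lemma p_stable_up : 0 < L s -> (l u < l (t * u)%g)%N ->
  p (x * u)%g (y * v)%g = 0.
Proof.
move=> Ls tu; apply: (eps_addN_reg Gamma_ordered AR Ls); rewrite p_kap //.
have TC : T s * C (y * v)%g = eps (L s) *: C (y * v)%g.
  by apply: T_C_desc => //; rewrite yvE (coxK WS _ Ss).
have := kap_T_stable_up Ss Xx XNsx W'u (C (y * v)%g) Ls Lt tu.
rewrite TC (formZ _ _ (coord_form mixed_basisP _)) mulrDl => ->.
by rewrite mulNr addNr.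
Qed.

Lemma p_stable_down : 0 < L s -> (l (t * u)%g < l u)%N ->
  p (x * u)%g (y * v)%g =
    (eps (L s) + eps (- L s)) * p (x * u)%g (s * y * v)%g
    - ptilde S S' M p s x u y v + p (x * t * u)%g (s * y * v)%g
    + \sum_(w \in [set w | [/\ W' w, bruhat_lt S u w & bruhat_lt S w (t * w)%g]])
        M t u w * p (x * w)%g (s * y * v)%g.
Proof.
move=> Ls tu; have W'tu : W' (t * u)%g.
  by apply: genM => //; apply: sub_gen; exact: stable_gen.
have xtuE : p (x * t * u)%g (s * y * v)%g = kap (C (s * y * v)%g) (x * t * u)%g.
  by rewrite -[(x * t * u)%g](mulgA x t u) p_kap.
rewrite C_recursion // (kap_T_stable_down Ss Xx XNsx W'u) // xtuE !p_kap //.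
set D := [set w | _]; set c := kap _ (x * u)%g; set d := kap _ (x * t * u)%g.
rewrite -/t; set Q := \sum_(w \in D) _ * kap _ _; set q := ptilde _ _ _ _ _ _ _ _ _.
have -> : \sum_(w \in D) M t u w * p (x * w)%g (s * y * v)%g = Q.
  by apply: eq_fsbigr => w /set_mem[W'w _ _]; rewrite p_kap.
rewrite mulrDl -!addrA; congr (_ + _).
by rewrite [RHS]addrA [RHS]addrC -addrA.
Qed.

End StableCase.

End Recursion.

End Coefficients.

End Relative.
End KazhdanLusztig.

Theorem proposition4p1
  (K : realType) (Rset : {pred K[i]}) (R : GRing.SubComNzRing.type Rset)
  (Gamma : porderZmodType) (Gamma_ordered : ordered_group Gamma)
  (W : groupType) (S : set W)
  (S_finite : finite_set S) (WS_coxeter : coxeter_system S)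
  (L : W -> Gamma) (L_weight : weight_function S L)
  (L_ge0 : forall s, S s -> 0 <= L s)
  (A : comAlgType R) (eps : Gamma -> A) (A_group_ring : is_group_ring eps)
  (bar : A -> A) (bar_A : is_group_ring_bar eps bar)
  (H : algType A) (T : W -> H) (H_hecke : is_hecke_algebra S L eps T)
  (barH : {rmorphism H -> H}) (bar_H : is_hecke_bar bar T barH)
  (C : W -> H) (C_KL : is_KL_basis S eps T barH C)
  (M : W -> W -> W -> A) (M_KL : is_KL_M S L eps T C M)
  (S' : set W) (S'_sub : S' `<=` S)
  (p : W -> W -> A) (p_KL : is_relative_KL S S' T C p) :
  let W' := gen_subgroup S' in
  let X := min_coset_reps S S' in
  forall x y u v : W, X x -> X y -> W' u -> W' v ->
  (* (a) *)
  (y = 1%g ->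
     (x = 1%g /\ u = v -> p (x * u)%g v = 1) /\
     (~ (x = 1%g /\ u = v) -> p (x * u)%g v = 0)) /\
  (* (b) *)
  (y <> 1%g -> forall s, S s -> bruhat_lt S (s * y)%g y ->
     let t := (x^-1 * s * x)%g in
     [/\ ~ X (s * x)%g -> S' t,
         L s = 0 ->
           (X (s * x)%g ->
              p (x * u)%g (y * v)%g = p (s * x * u)%g (s * y * v)%g) /\
           (~ X (s * x)%g ->
              p (x * u)%g (y * v)%g = p (x * t * u)%g (s * y * v)%g) &
         0 < L s ->
           [/\ bruhat_lt S (s * x)%g x ->
                 p (x * u)%g (y * v)%g =
                   p (s * x * u)%g (s * y * v)%g
                   + eps (L s) * p (x * u)%g (s * y * v)%g
                   - ptilde S S' M p s x u y v,
               bruhat_lt S x (s * x)%g -> X (s * x)%g ->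
                 p (x * u)%g (y * v)%g =
                   eps (- L s) * p (s * x * u)%g (y * v)%g,
               ~ X (s * x)%g -> bruhat_lt S u (t * u)%g ->
                 p (x * u)%g (y * v)%g = 0 &
               ~ X (s * x)%g -> bruhat_lt S (t * u)%g u ->
                 p (x * u)%g (y * v)%g =
                   (eps (L s) + eps (- L s)) * p (x * u)%g (s * y * v)%g
                   - ptilde S S' M p s x u y v
                   + p (x * t * u)%g (s * y * v)%g
                   + \sum_(w \in [set w | [/\ W' w, bruhat_lt S u w &
                                           bruhat_lt S w (t * w)%g]])
                       M t u w * p (x * w)%g (s * y * v)%g]]).
Proof.
move=> W' X x y u v Xx Xy W'u W'v; split.
  move=> _; rewrite (p_unit WS_coxeter A_group_ring H_hecke C_KL S'_sub p_KL) //.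
  split=> [[-> ->]|ne]; first by rewrite !eqxx.
  case: (eqVneq x 1%g) => [x1|//]; case: (eqVneq u v) => [uv|//].
  by case: ne.
move=> _ s Ss /(bruhat_ltP WS_coxeter _ Ss) sy t.
have S't : ~ X (s * x)%g -> S' t by exact: rep_asc.
(* [t] is the conjugate [s ^ x], so both generators carry the same weight. *)
have Lt : ~ X (s * x)%g -> L t = L s.
  move=> XNsx; case: L_weight => Lconj _; apply/esym.
  apply: (Lconj s t x) => //; first exact/S'_sub/S't.
  by rewrite /t conjgE mulgA.
have St : ~ X (s * x)%g -> S t by move=> /S't /S'_sub.
split=> // Ls; split.
- by apply: (p_eq0_move Gamma_ordered WS_coxeter A_group_ring bar_A H_hecke
    bar_H C_KL S'_sub p_KL).
- move=> XNsx.
  exact: (p_stable_eq0 Gamma_ordered WS_coxeter A_group_ring bar_A H_hecke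
    bar_H C_KL S'_sub p_KL Ss Xx Xy W'u W'v sy XNsx (Lt XNsx) Ls).
- move=> /(bruhat_ltP WS_coxeter _ Ss) sx.
  exact: (p_desc S_finite WS_coxeter A_group_ring H_hecke C_KL M_KL S'_sub p_KL).
- move=> /(bruhat_gtP _ Ss) sx Xsx.
  exact: (p_asc S_finite WS_coxeter A_group_ring H_hecke C_KL M_KL S'_sub p_KL).
- move=> XNsx /(bruhat_gtP _ (St XNsx)) tu.
  exact: (p_stable_up Gamma_ordered S_finite WS_coxeter A_group_ring H_hecke C_KL M_KL
    S'_sub p_KL Ss Xx Xy W'u W'v sy XNsx (Lt XNsx) Ls tu).
- move=> XNsx /(bruhat_ltP WS_coxeter _ (St XNsx)) tu.
  exact: (p_stable_down S_finite WS_coxeter A_group_ring H_hecke C_KL M_KL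
    S'_sub p_KL Ss Xx Xy W'u W'v sy XNsx (Lt XNsx) Ls tu).
Qed.
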